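(* Let $M$ be an oriented strictly pseudoconvex CR manifold of real dimension $2n+1$ with contact form $\theta$, let $x\in M$, let $\{Z_\alpha\}_{\alpha=1,\ldots,n}$ be a local orthonormal frame for $T_{1,0}$ around $x$, and let $\widehat X_\alpha=\sqrt2\,\mathrm{Re}Z_\alpha$, $\widehat X_{n+\alpha}=\sqrt2\,\mathrm{Im}Z_\alpha$ ($\alpha=1,\ldots,n$), $\widehat X_{2n+1}=T$. Then there are real constants $c_{j,i,J}$ ($j=1,\ldots,2n$, $i=1,\ldots,2n+1$, $J$ a multi-index) such that, in the Folland-Stein normal coordinates $(u^j)_{j=1,\ldots,2n+1}$ around $x$, for every integer $a\ge1$ and $\alpha=1,\ldots,n$, \[ \widehat X_{\alpha}=\frac{\partial}{\partial u^{\alpha}}-u^{n+\alpha}\frac{\partial}{\partial u^{2n+1}}+\sum_{i=1}^{2n}\Bigl(\sum_{1\le\lVert J\rVert\le a}c_{\alpha,i,J}u^J+O^{a+1}\Bigr)\frac{\partial}{\partial u^i}+\Bigl(\sum_{2\le\lVert J\rVert\le a}c_{\alpha,2n+1,J}u^J+O^{a+1}\Bigr)\frac{\partial}{\partial u^{2n+1}}, \] \[ \widehat X_{n+\alpha}=\frac{\partial}{\partial u^{n+\alpha}}+u^{\alpha}\frac{\partial}{\partial u^{2n+1}}+\sum_{i=1}^{2n}\Bigl(\sum_{1\le\lVert J\rVert\le a}c_{n+\alpha,i,J}u^J+O^{a+1}\Bigr)\frac{\partial}{\partial u^i}+\Bigl(\sum_{2\le\lVert J\rVert\le a}c_{n+\alpha,2n+1,J}u^J+O^{a+1}\Bigr)\frac{\partial}{\partial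 u^{2n+1}}. \] Moreover, each $c_{j,i,J}$ with $i=1,\ldots,2n+1$, $j=1,\ldots,2n$, $\lVert J\rVert=a$, is a polynomial of degree at most $a$ in (the coefficients, as polynomials in $u$, of) the quantities $\frac{d^b}{ds^b}C^{\alpha}_{\beta\gamma}(su)\big|_{s=0}$, $b\le a$, $\alpha,\beta,\gamma\in\{1,\ldots,2n+1\}$, where the $C^\alpha_{\beta\gamma}$ are the structure functions of the frame $(\widehat X_j)$.
   Context: CR structure. $M$ is a real oriented manifold of dimension $2n+1$, $n\ge1$, with a complex subbundle $T_{1,0}\subset \mathbb{C}TM$ of complex rank $n$ such that, with $T_{0,1}=\overline{T_{1,0}}$, $T_{1,0}\cap T_{0,1}=\{0\}$ and $[T_{1,0},T_{1,0}]\subset T_{1,0}$; $\theta$ is a real non-vanishing 1-form annihilating $H=\mathrm{Re}(T_{1,0}\oplus T_{0,1})$ such that the Levi form $L_\theta(Z,W)=-\sqrt{-1}\,d\theta(Z,W)$ is positive definite ($L_\theta(Z,\overline Z)>0$ for $0\ne Z\in T_{1,0}$). The convention is $d\theta(X,Y)=\frac12(X\theta(Y)-Y\theta(X)-\theta([X,Y]))$. $T$ is the unique real vector field with $T\rfloor d\theta=0$, $\theta(T)=1$. A local orthonormal frame $\{Z_\alpha\}$ for $T_{1,0}$ is a local frame with $L_\theta(Z_\alpha,\overline{Z_\beta})=\delta_{\alpha\beta}$ (equivalently, orthonormal for the Webster metric $g_\theta(X,Y)=d\theta(X,JY)$ on $H$, $J$ being the complex structure of $H$, extended $\mathbb{C}$-bilinearly).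 Folland-Stein normal coordinates. For $u\in\mathbb{R}^{2n+1}$ small, let $C_u:[0,1]\to M$ be the integral curve of $\sum_{j=1}^{2n+1}u^j\widehat X_j$ with $C_u(0)=x$, and $E_x(u)=C_u(1)$. $E_x$ is a diffeomorphism of a neighborhood $U_x$ of $0$ onto a neighborhood $V_x$ of $x$, and the coordinates $u^j$ given by $E_x^{-1}$ are the Folland-Stein normal coordinates. Functions on $V_x$ are regarded as functions of $u\in U_x$. Structure functions. $C^i_{jk}:U_x\to\mathbb{R}$ are defined by $[\widehat X_j,\widehat X_k]=\sum_{i=1}^{2n+1}C^i_{jk}\widehat X_i$. Notation. A function $f$ on $V_x$ is $O^a$ if $f(u)=O\bigl((\sum_{j=1}^{2n}|u^j|+|u^{2n+1}|^{1/2})^a\bigr)$ as $u\to0$. For a multi-index $J=(j_1,\ldots,j_b)$ with entries in $\{1,\ldots,2n+1\}$, $u^J=u^{j_1}\cdots u^{j_b}$ and $\lVert J\rVert=b+\#\{\nu: j_\nu=2n+1\}$. Since $\frac{d^b}{ds^b}C^\alpha_{\beta\gamma}(su)|_{s=0}$ is a homogeneous polynomial of degree $b$ in $u$, its coefficients are constants (partial derivatives of $C^\alpha_{\beta\gamma}$ at $0$ of order $b$, up to combinatorial factors). ''Is a polynomial'' means a polynomial whose coefficients depend only on $n,i,j,J$. *)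

(* Defs.v *)
From HB Require Import structures.
From mathcomp Require Import all_boot all_order all_algebra.
From mathcomp Require Import all_classical all_reals all_analysis.
From mathcomp Require Import complex.
(* The notations of mpoly clash with those of mathcomp-analysis. *)
From mathcomp Require Import -(notations) mpoly.
Set Implicit Arguments.
Unset Strict Implicit.
Unset Printing Implicit Defensive.
Import Order.TTheory GRing.Theory Num.Theory.
Import numFieldNormedType.Exports.
Local Open Scope classical_set_scope.
Local Open Scope ring_scope.
Local Open Scope complex_scope.

Section Euclidean.
Variables (R : realType) (N : nat).
Implicit Types (x u : 'rV[R]_N) (i : 'I_N).

Definition partial i (g : 'rV[R]_N -> R) : 'rV[R]_N -> R :=
  fun x => 'D_(delta_mx 0 i) g x.

Definition iter_partial (s : seq 'I_N) (g : 'rV[R]_N -> R) := foldr partial g s.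

(* C^oo on a neighbourhood of x: every iterated partial derivative is
   differentiable there. *)
Definition smooth_at (g : 'rV[R]_N -> R) x :=
  \forall y \near x, forall s, differentiable (iter_partial s g) y.

Definition csmooth_at (g : 'rV[R]_N -> R[i]) x :=
  smooth_at (fun y => complex.Re (g y)) x /\ smooth_at (fun y => complex.Im (g y)) x.

Definition cpartial i (g : 'rV[R]_N -> R[i]) x : R[i] :=
  partial i (fun y => complex.Re (g y)) x +i* partial i (fun y => complex.Im (g y)) x.

End Euclidean.

Section Manifold.
Variables (R : realType) (N : nat) (M : topologicalType).

(* [cmap] is meaningful on [cdom] and [cinv] on the image of [cdom]. *)
Record chart := Chart {
  cdom : set M;
  cmap : M -> 'rV[R]_N;
  cinv : 'rV[R]_N -> M }.

Record is_chart (c : chart) : Prop := {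
  chart_open_dom : open (cdom c);
  chart_open_im : open (cmap c @` cdom c);
  chart_cancel : forall p, cdom c p -> cinv c (cmap c p) = p;
  chart_cont : forall p, cdom c p -> {for p, continuous (cmap c)};
  chart_cont_inv : forall p, cdom c p -> {for cmap c p, continuous (cinv c)} }.

Definition transition (c d : chart) : 'rV[R]_N -> 'rV[R]_N := cmap d \o cinv c.

Record oriented_manifold (A : set chart) : Prop := {
  mfd_hausdorff : hausdorff_space M;
  mfd_countable : @second_countable M;
  mfd_chart : forall c, A c -> is_chart c;
  mfd_cover : forall p, exists2 c, A c & cdom c p;
  mfd_smooth : forall c d p, A c -> A d -> cdom c p -> cdom d p ->
    forall i, smooth_at (fun u => transition c d u 0 i) (cmap c p);
  mfd_oriented : forall c d p, A c -> A d -> cdom c p -> cdom d p ->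
    0 < \det ('J (transition c d) (cmap c p)) }.

Variable A : set chart.

Definition msmooth_at (f : M -> R[i]) (p : M) :=
  forall c, A c -> cdom c p -> csmooth_at (f \o cinv c) (cmap c p).

(* Complex tangent vectors at p are the C-linear derivations of the germs at p
   of smooth complex functions. A derivation is represented by a functional on
   all functions M -> C, which vanishes by convention on those that are not
   smooth near p; with this convention, equality of tangent vectors is
   equality. (That the value only depends on the germ follows from the Leibniz
   rule applied to indicator functions of neighbourhoods of p.) *)
Definition tvec := (M -> R[i]) -> R[i].

Record ctangent (p : M) (v : tvec) : Prop := {
  tan_linear : forall (a : R[i]) f g, msmooth_at f p -> msmooth_at g p ->
    v (fun q => a * f q + g q) = a * v f + v g;
  tan_leibniz : forall f g, msmooth_at f p -> msmooth_at g p ->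
    v (fun q => f q * g q) = f p * v g + g p * v f;
  tan_junk : forall f, ~ msmooth_at f p -> v f = 0 }.

Definition lincomb (I : finType) (a : I -> R[i]) (v : I -> tvec) : tvec :=
  fun f => \sum_i a i * v i f.

Definition conjv (v : tvec) : tvec := fun f => (v (fun q => (f q)^*))^*.
Definition realv (v : tvec) := conjv v = v.
Definition Rev (v : tvec) : tvec := fun f => 2^-1 * (v f + conjv v f).
Definition Imv (v : tvec) : tvec := fun f => (2 * 'i%C)^-1 * (v f - conjv v f).

Definition vfield := M -> tvec.

Definition smooth_vf (O : set M) (X : vfield) :=
  (forall p, O p -> ctangent p (X p)) /\
  (forall p f, O p -> msmooth_at f p -> msmooth_at (fun q => X q f) p).

Definition lie (X Y : vfield) : vfield := fun p f =>
  if `[< msmooth_at f p >]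
  then X p (fun q => Y q f) - Y p (fun q => X q f) else 0.

Definition oneform := M -> tvec -> R[i].

(* A smooth real 1-form, extended C-linearly to the complexified tangent
   spaces. *)
Record real_oneform (theta : oneform) : Prop := {
  form_linear : forall p (a : R[i]) v w, ctangent p v -> ctangent p w ->
    theta p (fun f => a * v f + w f) = a * theta p v + theta p w;
  form_real : forall p v, ctangent p v -> theta p (conjv v) = (theta p v)^*;
  form_smooth : forall O X, open O -> smooth_vf O X ->
    forall p, O p -> msmooth_at (fun q => theta q (X q)) p }.

Definition dform (theta : oneform) (X Y : vfield) (p : M) : R[i] :=
  2^-1 * (X p (fun q => theta q (Y q)) - Y p (fun q => theta q (X q))
          - theta p (lie X Y p)).

Definition levi (theta : oneform) (Z W : vfield) (p : M) : R[i] :=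
  - 'i%C * dform theta Z W p.

Definition conjvf (Z : vfield) : vfield := fun p => conjv (Z p).

Definition section_of (H : M -> set tvec) (O : set M) (X : vfield) :=
  smooth_vf O X /\ forall p, O p -> H p (X p).

Record local_frame (H : M -> set tvec) (r : nat) (O : set M)
    (Z : 'I_r -> vfield) : Prop := {
  frame_open : open O;
  frame_section : forall i, section_of H O (Z i);
  frame_free : forall p (a : 'I_r -> R[i]), O p ->
    lincomb a (fun i => Z i p) = (fun=> 0) -> forall i, a i = 0;
  frame_span : forall p, O p ->
    H p = [set v | exists a : 'I_r -> R[i], v = lincomb a (fun i => Z i p)] }.

Definition subbundle (r : nat) (H : M -> set tvec) :=
  forall p, exists O Z, O p /\ @local_frame H r O Z.

(* The real part H = Re(T10 + T01). *)
Definition levi_dist (T10 : M -> set tvec) (p : M) : set tvec :=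
  [set v | exists z w, [/\ T10 p z, T10 p w & v = Rev (fun f => z f + conjv w f)]].

Record cr_structure (n : nat) (T10 : M -> set tvec) : Prop := {
  cr_subbundle : subbundle n T10;
  cr_disjoint : forall p v, T10 p v -> (conjv @` T10 p) v -> v = (fun=> 0);
  cr_integrable : forall O Z W, open O ->
    section_of T10 O Z -> section_of T10 O W ->
    forall p, O p -> T10 p (lie Z W p) }.

(* d theta is evaluated on local sections; since it is tensorial, positivity on
   the values of local sections is positivity on vectors. *)
Record contact_form (T10 : M -> set tvec) (theta : oneform) : Prop := {
  contact_form1 : real_oneform theta;
  contact_nonvanishing : forall p, exists v,
    [/\ ctangent p v, realv v & theta p v != 0];
  contact_annihilates : forall p v, levi_dist T10 p v -> theta p v = 0;
  contact_pos : forall O Z, open O -> section_of T10 O Z ->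
    forall p, O p -> Z p <> (fun=> 0) -> 0 < levi theta Z (conjvf Z) p }.

Record reeb_field (theta : oneform) (T : vfield) : Prop := {
  reeb_smooth : smooth_vf setT T;
  reeb_real : forall p, realv (T p);
  reeb_contact : forall p, theta p (T p) = 1;
  reeb_dform : forall O Y, open O -> smooth_vf O Y ->
    forall p, O p -> dform theta T Y p = 0 }.

Definition orthonormal_frame (n : nat) (T10 : M -> set tvec) (theta : oneform)
    (O : set M) (Z : 'I_n -> vfield) :=
  local_frame T10 O Z /\
  forall p a b, O p -> levi theta (Z a) (conjvf (Z b)) p = (a == b)%:R.

(* On [0, 1], with one-sided derivatives at the end points; X is only
   meaningful on W. *)
Definition integral_curve (W : set M) (X : vfield) (x : M) (C : R -> M) :=
  [/\ C 0 = x, {within `[0, 1], continuous C}, (forall t, t \in `[0, 1] -> W (C t)) &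
      forall t (f : M -> R), t \in `[0, 1] ->
        msmooth_at (fun q => (f q)%:C) (C t) ->
        (s - t)^-1 * (f (C s) - f (C t)) @[s --> within `[0, 1] t^'] -->
          complex.Re (X (C t) (fun q => (f q)%:C))].

(* The coordinates induced by the diffeomorphism E : U -> V, with inverse F,
   where E u is the time-one point of the integral curve issued from x of the
   field \sum_j u^j X_j; integral curves are unique, which is why E u is equated
   with the time-one point of any such curve. *)
Record exp_coordinates (W : set M) (X : 'I_N -> vfield) (x : M)
    (U : set 'rV[R]_N) (V : set M) (E : 'rV[R]_N -> M) (F : M -> 'rV[R]_N)
    : Prop := {
  exp_open_dom : open U;
  exp_open_im : open V;
  exp_dom0 : U 0;
  exp_base : V x;
  exp_bij_l : forall u, U u -> V (E u) /\ F (E u) = u;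
  exp_bij_r : forall p, V p -> U (F p) /\ E (F p) = p;
  exp_smooth : forall u f, U u -> msmooth_at f (E u) -> csmooth_at (f \o E) u;
  exp_smooth_inv : forall p i, V p -> msmooth_at (fun q => (F q 0 i)%:C) p;
  exp_curve_ex : forall u, U u -> exists C,
    integral_curve W (fun p => lincomb (fun j => (u 0 j)%:C) (fun j => X j p)) x C;
  exp_curve : forall u C, U u ->
    integral_curve W (fun p => lincomb (fun j => (u 0 j)%:C) (fun j => X j p)) x C ->
    E u = C 1 }.

(* The coordinate vector d/du^i at the point E u. *)
Definition coord_vec (E : 'rV[R]_N -> M) (i : 'I_N) (u : 'rV[R]_N) : tvec :=
  fun f => if `[< msmooth_at f (E u) >] then cpartial i (f \o E) u else 0.

Definition structure_functions (X : 'I_N -> vfield) (U : set 'rV[R]_N)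
    (E : 'rV[R]_N -> M) (C : 'I_N -> 'I_N -> 'I_N -> 'rV[R]_N -> R) :=
  forall u j k, U u ->
    lie (X j) (X k) (E u) = lincomb (fun i => (C i j k u)%:C) (fun i => X i (E u)).

End Manifold.

(* Indices 1, ..., 2n+1 are 'I_(n + n).+1: alpha is [hor (lshift n alpha)],
   n + alpha is [hor (rshift n alpha)] and 2n+1 is [vert]. *)
Definition hor (n : nat) (k : 'I_(n + n)) : 'I_(n + n).+1 := lift ord_max k.
Definition vert (n : nat) : 'I_(n + n).+1 := ord_max.
Arguments vert {n}.

Definition real_frame (R : realType) (M : topologicalType) (n : nat)
    (Z : 'I_n -> vfield R M) (T : vfield R M) (j : 'I_(n + n).+1) : vfield R M :=
  fun p => match unlift ord_max j with
  | Some k => match fintype.split (k : 'I_(n + n)) with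
    | inl a => fun f => (Num.sqrt 2)%:C * Rev (Z a p) f
    | inr a => fun f => (Num.sqrt 2)%:C * Imv (Z a p) f
    end
  | None => T p
  end.

Section Weights.
Variables (R : realType) (n : nat).
Local Notation N := (n + n).+1.

(* Multi-indices are finite sequences of indices. *)
Definition wnorm (J : seq 'I_N) : nat := (size J + count_mem vert J)%N.

Definition hnorm (u : 'rV[R]_N) : R :=
  \sum_(k < n + n) `|u 0 (hor k)| + Num.sqrt `|u 0 vert|.

Definition weighted_O (a : nat) (r : 'rV[R]_N -> R) :=
  r =O_ (nbhs (0 : 'rV[R]_N)) (fun u => hnorm u ^+ a).

(* The sum of c_J u^J over lo <= ||J|| <= a; such J have at most a entries. *)
Definition wpoly (lo a : nat) (c : seq 'I_N -> R) (u : 'rV[R]_N) : R :=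
  \sum_(b < a.+1) \sum_(J : b.-tuple 'I_N | (lo <= wnorm J <= a)%N)
    c J * \prod_(k <- J) u 0 k.

(* q i j k m, for |m| = b, is the coefficient of u^m in the homogeneous
   polynomial d^b/ds^b C^i_jk(su) at s = 0. *)
Definition radial_coefs (C : 'I_N -> 'I_N -> 'I_N -> 'rV[R]_N -> R)
    (q : 'I_N -> 'I_N -> 'I_N -> multinom N -> R) :=
  forall i j k b (u : 'rV[R]_N),
    derive1n b (fun s : R => C i j k (s *: u)) 0 =
    \sum_(m : bmultinom N b.+1 | mdeg m == b)
      q i j k m * \prod_(l < N) u 0 l ^+ m l.

(* One variable for each i, j, k and each monomial u^m of degree at most a. *)
Definition coef_var (a : nat) : finType :=
  ('I_N * 'I_N * 'I_N * bmultinom N a.+1)%type.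

Definition structure_poly (a : nat) := mpoly #|coef_var a| R.

Definition coef_eval (a : nat) (P : structure_poly a)
    (q : 'I_N -> 'I_N -> 'I_N -> multinom N -> R) : R :=
  meval (fun v => let: (i, j, k, m) := (enum_val v : coef_var a) in q i j k m) P.

Definition degree_le (a d : nat) (P : structure_poly a) := (msize P <= d.+1)%N.

End Weights.

(* Main.v *)
(* In Folland-Stein coordinates the Euler field u^k d/du^k equals
   \sum_j u^j X_j, because s |-> E (s u) is the integral curve of the latter.
   Write X_j = \sum_i A_j^i d/du^i and let X_j X_k - X_k X_j =
   \sum_i C^i_jk X_i. Bracketing X_j with the Euler field gives, for D = A - 1
   and K_j^i = \sum_k u^k C^i_kj, the Riccati equation
     (Euler + 1) D = K + K D - D^2,  D(0) = 0.
   Its part of degree b is (b + 1) D_b = K_b + \sum_(0 < p < b) (K_p - D_p)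
   D_(b-p), which determines the Taylor coefficients of D as universal
   polynomials of degree at most b in those of C. The linear part of D_j^(2n+1)
   is half of \sum_k u^k C^(2n+1)_kj(0), and the orthonormality of the frame
   evaluates C^(2n+1)_kj = theta [X_k, X_j]. Since a monomial of ordinary degree
   b has weight between b and 2b, the ordinary Taylor expansion at order a
   yields the weighted one. That an abstract derivation is a combination of
   coordinate derivatives is Hadamard's lemma, whose smooth coefficients are
   the integrals \int_0^1 f(w + t (u - w)) dt. *)
Require Import Defs.
From HB Require Import structures.
From mathcomp Require Import all_boot all_order all_algebra.
From mathcomp Require Import all_classical all_reals all_analysis.
From mathcomp Require Import complex ring lra zify.
From mathcomp Require Import -(notations) mpoly.
Set Implicit Arguments.
Unset Strict Implicit.
Unset Printing Implicit Defensive.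
Import Order.TTheory GRing.Theory Num.Theory.
Import numFieldNormedType.Exports.
Local Open Scope classical_set_scope.
Local Open Scope ring_scope.
Local Open Scope complex_scope.

(** The polynomials must be fixed before the manifold, so the recursion is run in a ring with one
    indeterminate per coefficient of the structure functions and evaluated afterwards. It is solved
    over words, where a product of series is a sum over cuts of a word; but the data are indexed by
    monomials, so the coefficient of a monomial is shared evenly among its orderings. Each factor
    [K] uses up at least one letter and carries one indeterminate, which bounds the degree by the
    length of the word, hence by its weight. Two inputs have to be extracted from the abstract
    definitions. Integral curves are only tested against smooth functions, so the Euler identity is
    read at time one on the coordinate functions; its derivative gives A(0) = 1 and removes from the
    contracted bracket the terms that differentiate X_j. The structure functions come with no
    regularity; they are smooth near 0 because they solve a linear system whose matrix A is
    invertible there. The 1/2 in d theta and the sqrt 2 in the frame make theta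
    [X_alpha, X_(n+alpha)] equal to 2, and half of this is the coefficient 1 of the Heisenberg
    model. *)

Lemma near_forall (T : topologicalType) (I : finType) (P : I -> set T) (x : T) :
  (forall i, \forall y \near x, P i y) -> \forall y \near x, forall i, P i y.
Proof. exact: filter_forall. Qed.

(** * Smooth functions on R^N *)

Section SmoothCalculus.
Variables (R : realType) (N : nat).
Local Notation E := 'rV[R]_N.
Implicit Types (f g h : E -> R) (x y u : E) (i : 'I_N) (s : seq 'I_N).

Let lform (a : 'I_N -> R) (v : E) : R := \sum_i v 0 i * a i.

Fact lform_linear a : linear (lform a).
Proof.
move=> k u v; have -> : k *: lform a u = k * lform a u by [].
rewrite /lform mulr_sumr -big_split.
by apply: eq_bigr => i _; rewrite !mxE mulrDl mulrA.
Qed.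

HB.instance Definition _ a := @GRing.isLinear.Build R E R _ (lform a) (lform_linear a).

Lemma norm_coord_le x i : `|x 0 i| <= `|x|.
Proof.
rewrite [leRHS]/Num.Def.normr /= mx_normrE.
by apply/bigmax_geP; right => /=; exists (0, i).
Qed.

Lemma continuous_lform a : continuous (lform a).
Proof.
move=> x; apply: differentiable_continuous.
rewrite (_ : lform a = \sum_i ((fun v : E => v 0 i) * cst (a i))).
  apply: differentiable_sum => i; apply: differentiableM => //.
  exact: differentiable_coord.
by apply/funext => v; rewrite fct_sumE.
Qed.

Lemma diff_partial f x v : differentiable f x ->
  'd f x v = \sum_i v 0 i * partial i f x.
Proof.
move=> df; rewrite {1}[v]row_sum_delta linear_sum; apply: eq_bigr => i _.
by rewrite linearZ /partial deriveE.
Qed.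

Lemma differentiable_approx f x (e : R) : differentiable f x -> 0 < e ->
  \forall h \near (0 : E),
    `|f (h + x) - f x - \sum_i h 0 i * partial i f x| <= e * `|h|.
Proof.
move=> df e0; have /diff_locally := df => dfE.
have : f \o shift x - (cst (f x) + 'd f x) =o_ (0 : E) id.
  apply: eqoE. rewrite dfE. 
  rewrite [X in X - _]addrC addrK. reflexivity.
move=> /eqoP/(_ e e0); apply: filterS => h /=.
by rewrite -diff_partial // opprD addrA.
Qed.

(** The differential is informative only once differentiability is known. An explicit candidate
    gradient yields both differentiability and the partial derivatives, by uniqueness of the linear
    approximation. *)
Lemma approx_differentiable f x (a : 'I_N -> R) :
  (forall e, 0 < e -> \forall h \near (0 : E),
    `|f (h + x) - f x - \sum_i h 0 i * a i| <= e * `|h|) ->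
  differentiable f x /\ forall i, partial i f x = a i.
Proof.
move=> H.
have fE : f \o shift x = cst (f x) + lform a +o_ (0 : E) id.
  apply/eqaddoP => e e0; have := H e e0; apply: filterS => h.
  by rewrite opprD addrA.
have dfE : 'd f x = lform a :> (E -> R).
  by apply: diff_unique fE; exact: continuous_lform.
have df : differentiable f x.
  by apply/diff_locallyP; rewrite dfE; split => //; exact: continuous_lform.
split=> // i; rewrite /partial deriveE // dfE /lform (bigD1 i) //= big1.
  by rewrite mxE !eqxx mul1r addr0.
by move=> j ji; rewrite mxE eqxx /= (negbTE ji) mul0r.
Qed.

Lemma near_eq_differentiable f g x : {near x, f =1 g} ->
  differentiable f x -> differentiable g x.
Proof.
move=> fg df; apply: (proj1 (@approx_differentiable g x (fun i => partial i f x) _)).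
move=> e e0; have := differentiable_approx df e0.
have fgx := nbhs_singleton fg.
have : \forall h \near (0 : E), f (h + x) = g (h + x).
  by have := fg; rewrite (near_shift 0 x) /=; apply: filterS => h; rewrite subr0.
by apply: filterS2 => h <-; rewrite fgx.
Qed.

Lemma near_eq_partial i f g x : {near x, f =1 g} -> partial i f x = partial i g x.
Proof. by move=> fg; apply: near_eq_derive. Qed.

Lemma near_eq_near f g x : {near x, f =1 g} -> \forall y \near x, {near y, f =1 g}.
Proof. by move=> fg; apply: (near_join fg). Qed.

Lemma near_eq_iter_partial s f g x : {near x, f =1 g} ->
  {near x, iter_partial s f =1 iter_partial s g}.
Proof.
elim: s => //= i s IH /IH /near_eq_near; apply: filterS => y; exact: near_eq_partial.
Qed.

Lemma near_eq_smooth f g x : {near x, f =1 g} -> smooth_at f x -> smooth_at g x.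
Proof.
move=> /near_eq_near; apply: filterS2 => y fg H s.
by apply: near_eq_differentiable (H s); exact: near_eq_iter_partial.
Qed.

Definition smooth_on (D : set E) f := forall y s, D y -> differentiable (iter_partial s f) y.

Lemma smooth_atP f x : smooth_at f x <-> exists D, [/\ open D, D x & smooth_on D f].
Proof.
split=> [H|[D [oO Ox H]]].
  exists (interior [set y | forall s, differentiable (iter_partial s f) y]); split.
  - exact: open_interior.
  - exact: H.
  - by move=> y s /nbhs_singleton.
by have := open_nbhs_nbhs (conj oO Ox); apply: filterS => y Oy s; exact: H.
Qed.

Lemma smooth_near f x : smooth_at f x -> \forall y \near x, smooth_at f y.
Proof. by move=> H; apply: (near_join H). Qed.

Lemma smooth_differentiable f x : smooth_at f x -> differentiable f x.
Proof. by move=> /nbhs_singleton /(_ [::]). Qed.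

Lemma smooth_continuous f x : smooth_at f x -> {for x, continuous f}.
Proof. by move=> /smooth_differentiable /differentiable_continuous. Qed.

Lemma iter_partial_cat s t f : iter_partial (s ++ t) f = iter_partial s (iter_partial t f).
Proof. by rewrite /iter_partial foldr_cat. Qed.

Lemma smooth_iter_partial s f x : smooth_at f x -> smooth_at (iter_partial s f) x.
Proof. by apply: filterS => y H t; rewrite -iter_partial_cat. Qed.

Lemma smooth_partial i f x : smooth_at f x -> smooth_at (partial i f) x.
Proof. exact: (smooth_iter_partial [:: i]). Qed.

(* The subalgebra generated by a family [G] that is closed under
   differentiation up to this very algebra consists of smooth functions. *)
Inductive gen_alg (G : set (E -> R)) : (E -> R) -> Prop :=
| GenIn f : G f -> gen_alg G f
| GenCst c : gen_alg G (fun=> c)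
| GenAdd f g : gen_alg G f -> gen_alg G g -> gen_alg G (fun x => f x + g x)
| GenMul f g : gen_alg G f -> gen_alg G g -> gen_alg G (fun x => f x * g x).

Lemma partialD i f g x : differentiable f x -> differentiable g x ->
  partial i (fun y => f y + g y) x = partial i f x + partial i g x.
Proof. by move=> /diff_derivable ? /diff_derivable ?; exact: deriveD. Qed.

Lemma partialM i f g x : differentiable f x -> differentiable g x ->
  partial i (fun y => f y * g y) x = f x * partial i g x + g x * partial i f x.
Proof. by move=> /diff_derivable ? /diff_derivable ?; exact: deriveM. Qed.

Lemma partial_cst i c x : partial i (fun=> c) x = 0.
Proof. exact: derive_cst. Qed.

(** Induction on the word of derivatives: on [D] every iterated partial of a member coincides with
    another member. Openness of [D] allows an equality on [D] to be differentiated. *)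
Lemma gen_alg_smooth (G : set (E -> R)) (D : set E) : open D ->
  (forall f y, G f -> D y -> differentiable f y) ->
  (forall f i, G f -> exists2 g, gen_alg G g & forall y, D y -> partial i f y = g y) ->
  forall f, gen_alg G f -> smooth_on D f.
Proof.
move=> oO Gd Gp.
have algd f y : gen_alg G f -> D y -> differentiable f y.
  move=> Gf Oy; elim: Gf => {f} [f Gf|c|f g _ df _ dg|f g _ df _ dg] //.
  - exact: Gd.
  - exact: differentiableD.
  - exact: differentiableM.
have algp f i : gen_alg G f ->
    exists2 g, gen_alg G g & forall y, D y -> partial i f y = g y.
  elim=> {f} [f /Gp|c|f g Gf [f' Gf' Ef] Gg [g' Gg' Eg]|f g Gf [f' Gf' Ef] Gg [g' Gg' Eg]].
  - exact.
  - by exists (fun=> 0) => [|y _]; [exact: GenCst|rewrite partial_cst].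
  - exists (fun y => f' y + g' y) => [|y Oy]; first exact: GenAdd.
    by rewrite partialD ?Ef ?Eg //; exact: algd.
  - exists (fun y => f y * g' y + g y * f' y) => [|y Oy].
      by apply: GenAdd; exact: GenMul.
    by rewrite partialM ?Ef ?Eg //; exact: algd.
have algi f s : gen_alg G f ->
    exists2 g, gen_alg G g & forall y, D y -> iter_partial s f y = g y.
  move=> Gf; elim: s => [|i s [g Gg Eg]] /=; first by exists f.
  have [g' Gg' Eg'] := algp g i Gg; exists g' => // y Oy.
  rewrite -Eg' //; apply: near_eq_partial.
  by have := open_nbhs_nbhs (conj oO Oy); apply: filterS => z; exact: Eg.
move=> f Gf y s Oy; have [g Gg Eg] := algi f s Gf.
apply: near_eq_differentiable (algd g y Gg Oy).
by have := open_nbhs_nbhs (conj oO Oy); apply: filterS => z Oz; rewrite Eg.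
Qed.

Lemma smooth_on_nbhs (D : set E) f x : open D -> D x -> smooth_on D f -> smooth_at f x.
Proof. by move=> oO Ox H; apply/smooth_atP; exists D. Qed.

Lemma smooth_on_partial D f i : smooth_on D f -> smooth_on D (partial i f).
Proof. by move=> H y s Oy; have := H y (rcons s i) Oy; rewrite -cats1 iter_partial_cat. Qed.

Lemma gen_alg_smooth_on (D : set E) f : open D -> gen_alg (smooth_on D) f -> smooth_on D f.
Proof.
move=> oO; apply: gen_alg_smooth => // [g y sg Oy|g i sg]; first exact: (sg y [::]).
by exists (partial i g) => //; apply: GenIn; exact: smooth_on_partial.
Qed.

Lemma smooth_cst c x : smooth_at (fun=> c) x.
Proof.
apply: (@smooth_on_nbhs setT) => //; first exact: openT.
by apply: gen_alg_smooth_on; [exact: openT|exact: GenCst].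
Qed.

Lemma smooth2_on f g x : smooth_at f x -> smooth_at g x ->
  exists D, [/\ open D, D x, smooth_on D f & smooth_on D g].
Proof.
move=> /smooth_atP[D [oO Ox sf]] /smooth_atP[Q [oQ Qx sg]].
exists (D `&` Q); split=> //; first exact: openI.
- by move=> y s [Oy _]; exact: sf.
- by move=> y s [_ Qy]; exact: sg.
Qed.

Lemma smoothD f g x : smooth_at f x -> smooth_at g x ->
  smooth_at (fun y => f y + g y) x.
Proof.
move=> sf sg; have [D [oO Ox {}sf {}sg]] := smooth2_on sf sg.
apply: (smooth_on_nbhs oO Ox); apply: gen_alg_smooth_on => //.
by apply: GenAdd; exact: GenIn.
Qed.

Lemma smoothM f g x : smooth_at f x -> smooth_at g x ->
  smooth_at (fun y => f y * g y) x.
Proof.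
move=> sf sg; have [D [oO Ox {}sf {}sg]] := smooth2_on sf sg.
apply: (smooth_on_nbhs oO Ox); apply: gen_alg_smooth_on => //.
by apply: GenMul; exact: GenIn.
Qed.

Lemma smoothZ c f x : smooth_at f x -> smooth_at (fun y => c * f y) x.
Proof. by apply: smoothM; exact: smooth_cst. Qed.

Lemma smoothB f g x : smooth_at f x -> smooth_at g x ->
  smooth_at (fun y => f y - g y) x.
Proof.
move=> sf sg; apply: smoothD => //.
by under eq_fun do rewrite -mulN1r; exact: smoothZ.
Qed.

Lemma smooth_sum (I : finType) (P : pred I) (f : I -> E -> R) x :
  (forall k, smooth_at (f k) x) -> smooth_at (fun y => \sum_(k | P k) f k y) x.
Proof.
move=> sf; rewrite (_ : (fun y => _) = \sum_(k | P k) f k); last first.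
  by apply/funext => y; rewrite fct_sumE.
elim/big_rec: _ => [|k h _ sh]; first exact: smooth_cst.
exact: smoothD.
Qed.

Lemma gen_alg_sum G (I : Type) (r : seq I) (P : pred I) (f : I -> E -> R) :
  (forall k, gen_alg G (f k)) -> gen_alg G (fun y => \sum_(k <- r | P k) f k y).
Proof.
move=> Gf; rewrite (_ : (fun y => _) = \sum_(k <- r | P k) f k); last first.
  by apply/funext => y; rewrite fct_sumE.
by elim/big_rec: _ => [|k h _ Gh]; [exact: GenCst|exact: GenAdd].
Qed.

Lemma smooth_prod (I : Type) (r : seq I) (P : pred I) (f : I -> E -> R) x :
  (forall k, smooth_at (f k) x) -> smooth_at (fun y => \prod_(k <- r | P k) f k y) x.
Proof.
move=> sf; elim: r => [|k r IH].
  by under eq_fun do rewrite big_nil; exact: smooth_cst.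
by under eq_fun do rewrite big_cons; case: (P k) => //; exact: smoothM.
Qed.

Lemma partial_coord i k x : partial k (fun y : E => y 0 i) x = (k == i)%:R.
Proof.
apply: (proj2 (@approx_differentiable (fun y : E => y 0 i) x (fun k => (k == i)%:R) _)).
move=> e e0; near=> h; rewrite (bigD1 i) //= eqxx mulr1 big1 => [|j /negPf->].
  by rewrite addr0 mxE addrK subrr normr0 mulr_ge0 // ltW.
by rewrite mulr0.
Unshelve. all: by end_near. Qed.

Lemma smooth_coord i x : smooth_at (fun y : E => y 0 i) x.
Proof.
apply: (@smooth_on_nbhs setT) => //; first exact: openT.
apply: (@gen_alg_smooth [set f | f = (fun y : E => y 0 i)]).
- exact: openT.
- by move=> f y -> _; exact: differentiable_coord.
- move=> f k ->; exists (fun=> (k == i)%:R) => [|y _]; first exact: GenCst.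
  exact: partial_coord.
- exact: GenIn.
Qed.

(** The derivative of 1/f is minus (1/f)^2 times that of f, so the functions smooth on [Q] and 1/f
    together generate an algebra closed under differentiation; [Q] avoids the zeros of f. *)
Lemma smoothV f x : smooth_at f x -> f x != 0 -> smooth_at (fun y => (f y)^-1) x.
Proof.
move=> sf fx0; have /smooth_atP[D [oD Dx sfD]] := sf.
have nz : \forall y \near x, f y != 0.
  exact: (cvgr_neq0 (f x) (smooth_continuous sf)).
pose Q := D `&` interior [set y | f y != 0].
have oQ : open Q by apply: openI => //; exact: open_interior.
have Qnz y : Q y -> f y != 0 by case=> _ /nbhs_singleton.
apply: (@smooth_on_nbhs Q) => //.
pose G : set (E -> R) := smooth_on Q `|` [set fun y => (f y)^-1].
have GS g : smooth_on Q g -> gen_alg G g by move=> sg; apply: GenIn; left.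
have GV : gen_alg G (fun y => (f y)^-1) by apply: GenIn; right.
have sfQ : smooth_on Q f by move=> y s [Dy _]; exact: sfD.
apply: (@gen_alg_smooth G) => //.
- move=> g y [sg Qy|-> Qy]; first exact: (sg y [::]).
  by apply: differentiableV; [exact: (sfQ y [::])|exact: Qnz].
- move=> g i [sg|->].
    by exists (partial i g) => //; apply: GS; exact: smooth_on_partial.
  exists (fun y => -1 * ((f y)^-1 * ((f y)^-1 * partial i f y))) => [|y Qy].
    apply: GenMul; first exact: GenCst.
    do 2!apply: GenMul => //.
    by apply: GS; exact: smooth_on_partial.
  rewrite /partial deriveV ?Qnz //; last by apply: diff_derivable; exact: (sfQ y [::]).
  by rewrite expr2 invfM mulN1r -[_ *: _]/(_ * _) mulNr mulrA.
Qed.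

End SmoothCalculus.

(** * Composition of smooth maps and derivatives along rays *)

Section Chain.
Variables (R : realType) (m N : nat).
Implicit Types (phi : 'rV[R]_m -> 'rV[R]_N) (h : 'rV[R]_N -> R).

Lemma differentiable_row phi y :
  (forall l, differentiable (fun z => phi z 0 l) y) -> differentiable phi y.
Proof.
move=> dphi; rewrite (_ : phi = \sum_l (fun z => phi z 0 l *: delta_mx 0 l)); last first.
  by apply/funext => z; rewrite fct_sumE -row_sum_delta.
by apply: differentiable_sum => l; exact: differentiableZl.
Qed.

Lemma partial_comp phi h i y :
  (forall l, differentiable (fun z => phi z 0 l) y) -> differentiable h (phi y) ->
  partial i (h \o phi) y =
  \sum_l partial i (fun z => phi z 0 l) y * partial l h (phi y).
Proof.
move=> dphi dh; have dp := differentiable_row dphi.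
rewrite /partial deriveE; last exact: differentiable_comp.
rewrite diff_comp //= diff_partial //; apply: eq_bigr => l _; congr (_ * _).
by rewrite -deriveE // derive_mx ?mxE //; exact: diff_derivable.
Qed.

(** By the chain rule a partial of [k \o phi] is a sum of products of partials of [phi] with
    functions [partial l k \o phi]. With all compositions [k \o phi] among the generators, the
    algebra is therefore closed under differentiation. *)
Lemma smooth_comp phi h x : (forall l, smooth_at (fun z => phi z 0 l) x) ->
  smooth_at h (phi x) -> smooth_at (h \o phi) x.
Proof.
move=> sphi /smooth_atP[Q [oQ Qx sh]].
have cphi : {for x, continuous phi}.
  by apply/differentiable_continuous/differentiable_row => l; exact: smooth_differentiable.
have near1 : \forall y \near x, Q (phi y) /\
    forall l s, differentiable (iter_partial s (fun z => phi z 0 l)) y.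
  apply: filterI; first by apply: cphi; exact: open_nbhs_nbhs.
  exact: (near_forall sphi).
pose D := interior [set y | Q (phi y) /\
    forall l s, differentiable (iter_partial s (fun z => phi z 0 l)) y].
have oD : open D by exact: open_interior.
have DP y : D y -> Q (phi y) /\
    forall l s, differentiable (iter_partial s (fun z => phi z 0 l)) y.
  by move/nbhs_singleton.
apply: (@smooth_on_nbhs _ _ D) => //.
pose G : set ('rV[R]_m -> R) :=
  smooth_on D `|` [set g | exists2 k, smooth_on Q k & g = k \o phi].
have GS g : smooth_on D g -> gen_alg G g by move=> sg; apply: GenIn; left.
have sp l : smooth_on D (fun z => phi z 0 l) by move=> y s /DP[_].
apply: (@gen_alg_smooth _ _ G) => //; last by apply: GenIn; right; exists h.
- move=> g y [sg Dy|[k sk ->] Dy]; first exact: (sg y [::]).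
  have [Qy dp] := DP y Dy; apply: differentiable_comp.
    by apply: differentiable_row => l; exact: (dp l [::]).
  exact: (sk _ [::]).
- move=> g i [sg|[k sk ->]].
    by exists (partial i g) => //; apply: GS; exact: smooth_on_partial.
  exists (fun y => \sum_l partial i (fun z => phi z 0 l) y * (partial l k \o phi) y).
    apply: gen_alg_sum => l; apply: GenMul; first by apply: GS; exact: smooth_on_partial.
    by apply: GenIn; right; exists (partial l k) => //; exact: smooth_on_partial.
  move=> y /DP[Qy dp]; rewrite partial_comp //; first by move=> l; exact: (dp l [::]).
  exact: (sk _ [::]).
Qed.

End Chain.

Section Rays.
Variables (R : realType) (N : nat).
Local Notation E := 'rV[R]_N.
Implicit Types (g : E -> R) (u w : E).

Lemma is_derive_ray g w u (s : R) : differentiable g (w + s *: u) ->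
  is_derive s 1 (fun t : R => g (w + t *: u)) (\sum_k u 0 k * partial k g (w + s *: u)).
Proof.
move=> dg.
have eqf : (fun h : R => h^-1 *: (g (w + (h *: 1 + s) *: u) - g (w + s *: u))) =
    (fun h : R => h^-1 *: (g (h *: u + (w + s *: u)) - g (w + s *: u))).
  by apply/funext => h; rewrite [h *: 1]mulr1 scalerDl addrCA.
have dd := diff_derivable (v := u) dg.
split; first by rewrite /derivable eqf.
by rewrite /derive eqf -[LHS]/('D_u g (w + s *: u)) deriveE // diff_partial.
Qed.

Lemma is_derive_ray0 g u (s : R) : differentiable g (s *: u) ->
  is_derive s 1 (fun t : R => g (t *: u)) (\sum_k u 0 k * partial k g (s *: u)).
Proof.
have -> : (fun t : R => g (t *: u)) = (fun t : R => g (0 + t *: u)).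
  by apply/funext => t; rewrite add0r.
by rewrite -[s *: u]add0r; exact: is_derive_ray.
Qed.

Lemma is_derive_bigsum (I : Type) (r : seq I) (f : I -> R -> R) (df : I -> R) (s : R) :
  (forall i, is_derive s 1 (f i) (df i)) ->
  is_derive s 1 (fun t => \sum_(i <- r) f i t) (\sum_(i <- r) df i).
Proof.
move=> H; rewrite (_ : (fun t => _) = \sum_(i <- r) f i); last first.
  by apply/funext => y; rewrite fct_sumE.
by elim/big_ind2 : _ => // [|] *; [exact: is_derive_cst|exact: is_deriveD].
Qed.

Lemma is_derive_mulr_cst (f : R -> R) (df c s : R) : is_derive s 1 f df ->
  is_derive s 1 (fun t => f t * c) (df * c).
Proof.
move=> H; have : is_derive s 1 (f * cst c) (f s *: 0 + cst c s *: df).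
  exact: is_deriveM.
by rewrite scaler0 add0r /= [_ *: _]mulrC.
Qed.

End Rays.

(** * Taylor expansion *)

Section Taylor.
Variables (R : realType) (N : nat).
Local Notation E := 'rV[R]_N.
Implicit Types (f g : E -> R) (u w : E) (J : seq 'I_N).

Definition upow u J : R := \prod_(k <- J) u 0 k.

(** With ordered words in place of multi-indices, a monomial occurs once per ordering of its
    letters, and the single factor 1/b! replaces the multinomial denominators. *)
Definition taylor_part b g u : R :=
  (b`!%:R)^-1 * \sum_(J : b.-tuple 'I_N) iter_partial J g 0 * upow u J.

Lemma sum_tuple0 (V : nmodType) (F : seq 'I_N -> V) :
  \sum_(J : 0.-tuple 'I_N) F J = F [::].
Proof.
rewrite (bigD1 [tuple]) //= big1 ?addr0 // => J.
by case/negP; apply/eqP; exact: tuple0.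
Qed.

Lemma sum_tupleS (V : nmodType) b (F : seq 'I_N -> V) :
  \sum_(J : b.+1.-tuple 'I_N) F J = \sum_k \sum_(J : b.-tuple 'I_N) F (k :: J).
Proof.
rewrite pair_big /=.
rewrite (reindex (fun p : 'I_N * b.-tuple 'I_N => [tuple of p.1 :: p.2])) //=.
exists (fun t : b.+1.-tuple 'I_N => (thead t, [tuple of behead t])) => [[k J] _|t _] /=.
  by rewrite theadE; congr (_, _); exact: val_inj.
by rewrite -tuple_eta.
Qed.

(** [iter_partial] is a right fold: the last letter is the derivative taken first, and removing it
    leaves a Taylor part of [partial k g]. *)
Lemma sum_tuple_rcons (V : nmodType) b (F : seq 'I_N -> V) :
  \sum_(J : b.+1.-tuple 'I_N) F J = \sum_k \sum_(J : b.-tuple 'I_N) F (rcons J k).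
Proof.
elim: b F => [|b IH] F; rewrite sum_tupleS.
  apply: eq_bigr => k _.
  by rewrite (sum_tuple0 (fun J => F (k :: J))) (sum_tuple0 (fun J => F (rcons J k))).
under eq_bigr do rewrite (IH (fun J => F (_ :: J))).
rewrite exchange_big /=; apply: eq_bigr => k _.
by rewrite (sum_tupleS b (fun J => F (rcons J k))).
Qed.

Lemma upow_cons u k J : upow u (k :: J) = u 0 k * upow u J.
Proof. by rewrite /upow big_cons. Qed.

Lemma upow_cat u I J : upow u (I ++ J) = upow u I * upow u J.
Proof. by rewrite /upow big_cat. Qed.

Lemma upow_rcons u k J : upow u (rcons J k) = upow u J * u 0 k.
Proof. by rewrite -cats1 upow_cat /upow big_seq1. Qed.

Lemma upowZ (s : R) u J : upow (s *: u) J = s ^+ size J * upow u J.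
Proof.
elim: J => [|k J IH]; first by rewrite /upow !big_nil mulr1.
by rewrite !upow_cons IH mxE exprS mulrACA.
Qed.

Lemma taylor_part0 g u : taylor_part 0 g u = g 0.
Proof.
rewrite /taylor_part fact0 invr1 mul1r.
by rewrite (sum_tuple0 (fun J => iter_partial J g 0 * upow u J)) /upow big_nil mulr1.
Qed.

(** This recursion drives the inductions on the degree below: passing to the first partial
    derivatives lowers the degree by one. *)
Lemma taylor_partS b g u :
  b.+1%:R * taylor_part b.+1 g u = \sum_k u 0 k * taylor_part b (partial k g) u.
Proof.
rewrite /taylor_part (sum_tuple_rcons b (fun J => iter_partial J g 0 * upow u J)).
rewrite factS natrM invfM mulrA mulrA divff ?pnatr_eq0 // mul1r mulr_sumr.
apply: eq_bigr => k _; rewrite mulrCA; congr (_ * _); rewrite mulr_sumr.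
apply: eq_bigr => J _; rewrite -cats1 iter_partial_cat cats1 upow_rcons.
by rewrite mulrA mulrC.
Qed.

Lemma taylor_part_near b f g u : {near (0 : E), f =1 g} ->
  taylor_part b f u = taylor_part b g u.
Proof.
move=> fg; congr (_ * _); apply: eq_bigr => J _; congr (_ * _).
exact: (nbhs_singleton (near_eq_iter_partial J fg)).
Qed.

Lemma iter_partialD J f g x : smooth_at f x -> smooth_at g x ->
  iter_partial J (fun y => f y + g y) x = iter_partial J f x + iter_partial J g x.
Proof.
move=> sf sg.
suff: {near x, iter_partial J (fun y => f y + g y) =1
    (fun y => iter_partial J f y + iter_partial J g y)} by move/nbhs_singleton.
elim: J => [|k J IH] /=; first by near=> y.
have := near_eq_near IH; apply: filterS3 sf sg => y sf sg H.
by rewrite (near_eq_partial _ H) partialD.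
Unshelve. all: by end_near. Qed.

Lemma taylor_partD b f g u : smooth_at f 0 -> smooth_at g 0 ->
  taylor_part b (fun y => f y + g y) u = taylor_part b f u + taylor_part b g u.
Proof.
move=> sf sg; rewrite /taylor_part -mulrDr -big_split; congr (_ * _).
by apply: eq_bigr => J _; rewrite iter_partialD // mulrDl.
Qed.

Lemma taylor_part_cst b (c : R) u : taylor_part b (fun=> c) u = (b == 0%N)%:R * c.
Proof.
elim: b c => [|b IH] c; first by rewrite taylor_part0 mul1r.
apply: (mulfI (x := b.+1%:R)); first by rewrite pnatr_eq0.
rewrite taylor_partS mul0r mulr0 big1 // => k _.
rewrite (_ : partial k _ = fun=> 0); first by rewrite IH mulr0 mulr0.
by apply/funext => y; rewrite partial_cst.
Qed.

Lemma taylor_part_sum (I : Type) (r : seq I) (f : I -> E -> R) b u :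
  (forall i, smooth_at (f i) 0) ->
  taylor_part b (fun y => \sum_(i <- r) f i y) u = \sum_(i <- r) taylor_part b (f i) u.
Proof.
move=> sf; elim: r => [|i r IH].
  by under eq_fun do rewrite big_nil; rewrite taylor_part_cst big_nil mulr0.
under eq_fun do rewrite big_cons; rewrite taylor_partD // ?IH ?big_cons //.
have -> : (fun x : E => \sum_(j <- r) f j x) = \sum_(j <- r) f j.
  by apply/funext => y; rewrite fct_sumE.
elim/big_rec: _ => [|k h _ sh]; [exact: smooth_cst|exact: smoothD].
Qed.

Lemma taylor_partM b f g u : smooth_at f 0 -> smooth_at g 0 ->
  taylor_part b (fun y => f y * g y) u =
  \sum_(p < b.+1) taylor_part p f u * taylor_part (b - p) g u.
Proof.
elim: b f g => [|b IH] f g sf sg.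
  by rewrite big_ord1 !taylor_part0.
apply: (mulfI (x := b.+1%:R)); first by rewrite pnatr_eq0.
rewrite taylor_partS.
have E1 k : taylor_part b (partial k (fun y => f y * g y)) u =
    \sum_(p < b.+1) taylor_part p f u * taylor_part (b - p) (partial k g) u +
    \sum_(p < b.+1) taylor_part p (partial k f) u * taylor_part (b - p) g u.
  have sfk := smooth_partial k sf; have sgk := smooth_partial k sg.
  rewrite -!IH // -taylor_partD //; try exact: smoothM.
  apply: taylor_part_near.
  have := sf; apply: filterS2 sg => y /(_ [::]) dg /(_ [::]) df.
  by rewrite partialM // [partial k f y * _]mulrC.
under eq_bigr do rewrite E1 mulrDr !mulr_sumr.
rewrite big_split /= exchange_big /= [X in _ + X]exchange_big /=.
have E2 (p : 'I_b.+1) : \sum_k u 0 k * (taylor_part p f u * taylor_part (b - p) (partial k g) u)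
    = (b.+1 - p)%:R * (taylor_part p f u * taylor_part (b.+1 - p) g u).
  rewrite [RHS]mulrCA subSn -1?ltnS // taylor_partS mulr_sumr.
  by apply: eq_bigr => k _; rewrite mulrCA.
have E3 (p : 'I_b.+1) : \sum_k u 0 k * (taylor_part p (partial k f) u * taylor_part (b - p) g u)
    = p.+1%:R * (taylor_part p.+1 f u * taylor_part (b.+1 - p.+1) g u).
  rewrite mulrA taylor_partS subSS mulr_suml.
  by apply: eq_bigr => k _; rewrite mulrA.
under eq_bigr do rewrite E2; under [X in _ + X]eq_bigr do rewrite E3.
rewrite mulr_sumr.
(* The factor b + 1 is split as (b + 1 - p) + p. The first share comes from the terms that
   differentiate [g], the second from those that differentiate [f]; in each sum the missing extreme
   term has weight zero. *)
have -> : \sum_(p < b.+2) b.+1%:R * (taylor_part p f u * taylor_part (b.+1 - p) g u) =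
  \sum_(p < b.+2) (b.+1 - p)%:R * (taylor_part p f u * taylor_part (b.+1 - p) g u) +
  \sum_(p < b.+2) p%:R * (taylor_part p f u * taylor_part (b.+1 - p) g u).
  rewrite -big_split; apply: eq_bigr => p _ /=.
  by rewrite -mulrDl -natrD subnK // -ltnS.
congr (_ + _).
  by rewrite [RHS]big_ord_recr /= subnn mul0r addr0.
by rewrite [RHS]big_ord_recl /= mul0r add0r.
Qed.

Lemma taylor_part_coord b i u :
  taylor_part b (fun y : E => y 0 i) u = (b == 1%N)%:R * u 0 i.
Proof.
case: b => [|b]; first by rewrite taylor_part0 mxE mul0r.
apply: (mulfI (x := b.+1%:R)); first by rewrite pnatr_eq0.
rewrite taylor_partS (eq_bigr (fun k => u 0 k * ((b == 0)%:R * (k == i)%:R))); last first.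
  move=> k _; rewrite -(taylor_part_cst b _ u); congr (_ * taylor_part b _ u).
  by apply/funext => y; rewrite partial_coord.
rewrite (bigD1 i) //= big1 => [|k /negPf ->]; last by rewrite !mulr0.
by rewrite eqxx mulr1 addr0 mulrC; case: b => [|b] //=; rewrite ?mul1r // !mul0r mulr0.
Qed.

Lemma taylor_part_coordM b i g u : smooth_at g 0 ->
  taylor_part b.+1 (fun y : E => y 0 i * g y) u = u 0 i * taylor_part b g u.
Proof.
move=> sg; rewrite taylor_partM //; last exact: smooth_coord.
under eq_bigr do rewrite taylor_part_coord.
rewrite !big_ord_recl /= mul0r mul0r add0r mul1r subSS subn0.
by rewrite big1 ?addr0 // => k _; rewrite !mul0r.
Qed.

Lemma taylor_part_euler b g u : smooth_at g 0 ->
  taylor_part b (fun y : E => \sum_k y 0 k * partial k g y) u = b%:R * taylor_part b g u.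
Proof.
move=> sg; have sk k := smooth_partial k sg.
rewrite taylor_part_sum; last by move=> k; apply: smoothM => //; exact: smooth_coord.
case: b => [|b].
  by rewrite mul0r big1 // => k _; rewrite taylor_part0 mxE mul0r.
by rewrite taylor_partS; apply: eq_bigr => k _; rewrite taylor_part_coordM.
Qed.

Lemma taylor_partZ b g (s : R) u : taylor_part b g (s *: u) = s ^+ b * taylor_part b g u.
Proof.
rewrite /taylor_part mulrCA; congr (_ * _); rewrite mulr_sumr.
by apply: eq_bigr => J _; rewrite upowZ size_tuple mulrCA.
Qed.

Lemma near_ray (P : set E) u : (\forall y \near (0 : E), P y) ->
  \forall s \near (0 : R), P (s *: u).
Proof.
move=> HP; have : (fun s : R => s *: u) @ (0 : R) --> (0 *: u : E).
  exact: scalel_continuous.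
by rewrite scale0r; apply.
Qed.

Lemma derive1n_ray b g u : smooth_at g 0 ->
  derive1n b (fun s : R => g (s *: u)) 0 = b`!%:R * taylor_part b g u.
Proof.
move=> sg; rewrite /taylor_part mulrA divff ?pnatr_eq0 -?lt0n ?fact_gt0 // mul1r.
(* The equality is claimed for all [s] near 0 so that the induction may differentiate it once
   more. *)
suff: \forall s \near (0 : R), derive1n b (fun s : R => g (s *: u)) s =
    \sum_(J : b.-tuple 'I_N) iter_partial J g (s *: u) * upow u J.
  by move/nbhs_singleton; rewrite scale0r.
elim: b => [|b IH].
  near=> s; rewrite (sum_tuple0 (fun J => iter_partial J g (s *: u) * upow u J)).
  by rewrite /upow big_nil mulr1.
have IH' := near_join IH.
have := near_ray u sg; apply: filterS2 IH' => s IHs ds.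
rewrite derive1nS derive1E (near_eq_derive _ IHs).
have dJ (J : b.-tuple 'I_N) : is_derive s 1
    (fun t : R => iter_partial J g (t *: u) * upow u J)
    ((\sum_k u 0 k * partial k (iter_partial J g) (s *: u)) * upow u J).
  exact/is_derive_mulr_cst/is_derive_ray0.
rewrite (derive_val (is_derive := is_derive_bigsum (index_enum _) dJ)).
rewrite (sum_tupleS b (fun J => iter_partial J g (s *: u) * upow u J)) exchange_big /=.
apply: eq_bigr => J _; rewrite mulr_suml; apply: eq_bigr => k _.
by rewrite upow_cons mulrA [u 0 k * _]mulrC.
Unshelve. all: by end_near. Qed.

(** Along the ray to [u], the derivative of the remainder of order a + 1 is the sum of [u 0 k] times
    the remainders of order a of the first partials. The mean value theorem transfers their bounds,
    and each [u 0 k] supplies one more power of the norm. *)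
Lemma taylor_bound a g : smooth_at g 0 -> exists K, \forall u \near (0 : E),
  `|g u - \sum_(b < a) taylor_part b g u| <= K * `|u| ^+ a.
Proof.
elim: a g => [|a IH] g sg.
  exists (`|g 0| + 1).
  have := smooth_continuous sg => /cvgr_norm_lt /(_ (`|g 0| + 1)).
  rewrite ltrDl ltr01 => /(_ isT); apply: filterS => u /ltW.
  by rewrite big_ord0 subr0 expr0 mulr1.
have /choice[K HK] : forall k, exists K, \forall u \near (0 : E),
    `|partial k g u - \sum_(b < a) taylor_part b (partial k g) u| <= K * `|u| ^+ a.
  by move=> k; apply: IH; exact: smooth_partial.
have HK' : \forall u \near (0 : E), differentiable g u /\ forall k,
    `|partial k g u - \sum_(b < a) taylor_part b (partial k g) u| <= K k * `|u| ^+ a.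
  apply: filterI; first by apply: filterS sg => y /(_ [::]).
  exact: (near_forall HK).
have /nbhs_normP[e e0 He] := HK'.
have small : \forall u \near (0 : E), `|u| < e.
  by apply/nbhs_normP; exists e => // u; rewrite /ball_ /= sub0r normrN.
exists (\sum_k `|K k|); apply: filterS small => u small.
have ue (t : R) : 0 <= t <= 1 -> ball_ Num.Def.normr 0 e (t *: u).
  case/andP=> t0 t1; rewrite /ball_ /= sub0r normrN normrZ (ger0_norm t0).
  apply: (@le_lt_trans _ _ `|u|); last exact: small.
  by rewrite ler_piMl.
pose rho (t : R) := g (t *: u) - \sum_(b < a.+1) taylor_part b g (t *: u).
pose drho (t : R) := \sum_k u 0 k * (partial k g (t *: u) -
   \sum_(b < a) taylor_part b (partial k g) (t *: u)).
have drhoP (t : R) : 0 <= t <= 1 -> is_derive t 1 rho (drho t).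
  move=> t01; have [dg _] := He _ (ue t t01).
  have H1 := is_derive_ray0 dg.
  have H2 (b : nat) : is_derive t 1 (fun s : R => taylor_part b g (s *: u))
      (b%:R * t ^+ b.-1 * taylor_part b g u).
    rewrite (_ : (fun s : R => _) = (fun s : R => s ^+ b * taylor_part b g u)); last first.
      by apply/funext => s; rewrite taylor_partZ.
    apply: is_derive_mulr_cst; split; first exact: exprn_derivable.
    by rewrite exp_derive [_ *: 1]mulr1.
  have H3 := is_derive_bigsum (index_enum 'I_a.+1) (fun b : 'I_a.+1 => H2 b).
  have := is_deriveB H1 H3; rewrite /rho => H.
  apply: is_derive_eq H _.
  rewrite big_ord_recl /= !mul0r add0r /drho.
  under [in RHS]eq_bigr do rewrite mulrBr mulr_sumr.
  rewrite sumrB; congr (_ - _); rewrite exchange_big /=; apply: eq_bigr => b _.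
  rewrite mulrAC taylor_partS mulr_suml; apply: eq_bigr => k _.
  by rewrite taylor_partZ -mulrA [_ * t ^+ _]mulrC.
have rho0 : rho 0 = 0.
  rewrite /rho scale0r big_ord_recl big1 => [|b _].
    by rewrite taylor_part0 addr0 subrr.
  by rewrite -(scale0r u) taylor_partZ /= exprS !mul0r.
have [c c01] : exists2 c, c \in `[0, 1]%R & rho 1 - rho 0 = drho c * (1 - 0).
  apply: MVT_segment => // [t|].
    by rewrite in_itv /= => /andP[t0 t1]; apply: drhoP; rewrite !ltW.
  apply: derivable_within_continuous => t; rewrite in_itv /= => t01.
  by have [] := drhoP t t01.
rewrite rho0 !subr0 mulr1 {1}/rho scale1r => ->.
move: c01; rewrite in_itv /= => c01; have [_ Kc] := He _ (ue c c01).
rewrite /drho (le_trans (ler_norm_sum _ _ _)) // mulr_suml; apply: ler_sum => k _.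
rewrite normrM exprS mulrCA; apply: ler_pM => //; first exact: norm_coord_le.
apply: le_trans (Kc k) _; apply: (@le_trans _ _ (`|K k| * `|c *: u| ^+ a)).
  by rewrite ler_wpM2r ?exprn_ge0 ?ler_norm.
rewrite ler_wpM2l // lerXn2r ?nnegrE // normrZ; case/andP: c01 => c0 c1.
by rewrite (ger0_norm c0) ler_piMl.
Qed.

End Taylor.

(** * Hadamard's lemma *)

Section UnitIntegral.
Variable R : realType.
Implicit Types f g : R -> R.

Definition int01 f : R := \int[@lebesgue_measure R]_(t in `[0, 1]) f t.

Definition cont01 f := forall t : R, 0 <= t <= 1 -> {for t, continuous f}.

Lemma cont01_integrable f : cont01 f ->
  (@lebesgue_measure R).-integrable `[0, 1] (EFin \o f).
Proof.
move=> cf; apply: continuous_compact_integrable; first exact: segment_compact.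
apply: continuous_in_subspaceT => t; rewrite inE /= in_itv /=; exact: cf.
Qed.

Lemma int01D f g : cont01 f -> cont01 g ->
  int01 (fun t => f t + g t) = int01 f + int01 g.
Proof. by move=> cf cg; rewrite /int01 RintegralD //; exact: cont01_integrable. Qed.

Lemma int01Z (c : R) f : cont01 f -> int01 (fun t => c * f t) = c * int01 f.
Proof. by move=> cf; rewrite /int01 RintegralZl //; exact: cont01_integrable. Qed.

Lemma eq_int01 f g : (forall t, 0 <= t <= 1 -> f t = g t) -> int01 f = int01 g.
Proof.
move=> fg; apply: eq_Rintegral => t; rewrite inE /= in_itv /=; exact: fg.
Qed.

Lemma cont01_cst (c : R) : cont01 (fun=> c).
Proof. by move=> t _; exact: cst_continuous. Qed.

Lemma cont01D f g : cont01 f -> cont01 g -> cont01 (fun t => f t + g t).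
Proof. by move=> cf cg t t01; apply: continuousD; [exact: cf|exact: cg]. Qed.

Lemma cont01M f g : cont01 f -> cont01 g -> cont01 (fun t => f t * g t).
Proof. by move=> cf cg t t01; apply: continuousM; [exact: cf|exact: cg]. Qed.

Lemma cont01_sum (I : Type) (r : seq I) (f : I -> R -> R) :
  (forall i, cont01 (f i)) -> cont01 (fun t => \sum_(i <- r) f i t).
Proof.
move=> cf; elim: r => [|i r IH].
  by under eq_fun do rewrite big_nil; exact: cont01_cst.
by under eq_fun do rewrite big_cons; exact: cont01D.
Qed.

Lemma int01_sum (I : Type) (r : seq I) (f : I -> R -> R) :
  (forall i, cont01 (f i)) ->
  int01 (fun t => \sum_(i <- r) f i t) = \sum_(i <- r) int01 (f i).
Proof.
move=> cf; elim: r => [|i r IH].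
  under [in LHS]eq_fun do rewrite big_nil.
  by rewrite big_nil /int01 Rintegral_cst // mul0r.
under [in LHS]eq_fun do rewrite big_cons.
by rewrite big_cons int01D ?IH //; exact: cont01_sum.
Qed.

Lemma int01_cst (c : R) : int01 (fun=> c) = c.
Proof.
rewrite /int01 Rintegral_cst //.
rewrite -[X in fine X]/(lebesgue_measure [set` `[0%R, 1%R]%R]) lebesgue_measure_itv /= lte_fin ltr01.
by rewrite oppr0 adde0 mulr1.
Qed.

Lemma int01_bound f (c : R) : cont01 f -> (forall t, 0 <= t <= 1 -> `|f t| <= c) ->
  `|int01 f| <= c.
Proof.
move=> cf fc; apply: le_trans (le_normr_Rintegral _ (cont01_integrable cf)) _ => //.
rewrite -[leRHS]int01_cst; apply: le_Rintegral => //.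
- apply: (@cont01_integrable (fun t => `|f t|)) => t t01.
  by apply: continuous_comp; [exact: cf|exact: norm_continuous].
- by apply: (@cont01_integrable (fun=> c)); exact: cont01_cst.
Qed.

Lemma int01_FTC f g : cont01 g ->
  (forall t : R, 0 <= t <= 1 -> is_derive t 1 f (g t)) -> int01 g = f 1 - f 0.
Proof.
move=> cg fg; rewrite /int01 /Rintegral (@continuous_FTC2 _ g f) //.
- apply: continuous_in_subspaceT => t; rewrite inE /= in_itv /=; exact: cg.
- have cf t : 0 <= t <= 1 -> {for t, continuous f}.
    move=> /fg[df _]; exact/differentiable_continuous/derivable1_diffP.
  split.
  + by move=> t; rewrite in_itv /= => /andP[t0 t1]; have [] := fg t; rewrite ?ltW.
  + by apply: cvg_at_right_filter; apply: cf; rewrite lexx ler01.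
  + by apply: cvg_at_left_filter; apply: cf; rewrite lexx ler01.
- move=> t; rewrite in_itv /= => /andP[t0 t1]; rewrite derive1E.
  by have [|_ ->] := fg t; rewrite ?ltW.
Qed.

End UnitIntegral.

Section Hadamard.
Variables (R : realType) (N : nat).
Local Notation E := 'rV[R]_N.
Implicit Types (f g : E -> R) (u y z : E).

(** Mean value theorem for f(y + s z) minus s times the differential of f at y along z: the
    derivative in s involves only differences of partials, which [eps] bounds. *)
Lemma first_order_bound f y z (eps : R) :
  (forall s : R, 0 <= s <= 1 -> differentiable f (y + s *: z)) ->
  (forall (s : R) i, 0 <= s <= 1 -> `|partial i f (y + s *: z) - partial i f y| <= eps) ->
  `|f (z + y) - f y - \sum_i z 0 i * partial i f y| <= N%:R * eps * `|z|.
Proof.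
move=> df bd.
pose h (s : R) := f (y + s *: z) - s * \sum_i z 0 i * partial i f y.
pose dh (s : R) := \sum_i z 0 i * (partial i f (y + s *: z) - partial i f y).
have dhP (s : R) : 0 <= s <= 1 -> is_derive s 1 h (dh s).
  move=> s01; have H1 := is_derive_ray (df s s01).
  have H2 := is_derive_mulr_cst (\sum_i z 0 i * partial i f y) (is_derive_id s (1 : R)).
  apply: is_derive_eq (is_deriveB H1 H2) _.
  by rewrite mul1r -sumrB; apply: eq_bigr => i _; rewrite mulrBr.
have [c c01] : exists2 c, c \in `[0, 1]%R & h 1 - h 0 = dh c * (1 - 0).
  apply: MVT_segment => // [t|].
    by rewrite in_itv /= => /andP[t0 t1]; apply: dhP; rewrite !ltW.
  apply: derivable_within_continuous => t; rewrite in_itv /= => t01.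
  by have [] := dhP t t01.
rewrite subr0 mulr1 /h scale1r scale0r addr0 mul1r mul0r subr0 => E1.
rewrite [z + y]addrC addrAC E1 /dh (le_trans (ler_norm_sum _ _ _)) //.
apply: (@le_trans _ _ (\sum_(i < N) eps * `|z|)).
  apply: ler_sum => i _; rewrite normrM mulrC; apply: ler_pM => //.
    by apply: bd; move: c01; rewrite in_itv.
  exact: norm_coord_le.
by rewrite sumr_const card_ord -mulrA mulr_natl.
Qed.

Variables (w : E) (e : R).

(** The weight t^k makes the family stable under differentiation: each partial derivative under the
    integral sign brings out one more factor t. *)
Definition cone_int k f u := int01 (fun t => t ^+ k * f (w + t *: (u - w))).

Let B : set E := [set y | `|y - w| < e].

Let B_open : open B.
Proof.
rewrite (_ : B = ball w e); first exact: ball_open.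
rewrite -ball_normE.
by apply/seteqP; split=> y; rewrite /ball_ /B /= distrC.
Qed.

Let B_cone u t : B u -> 0 <= t <= 1 -> B (w + t *: (u - w)).
Proof.
move=> Bu /andP[t0 t1]; rewrite /B /= addrAC subrr add0r normrZ ger0_norm //.
by apply: le_lt_trans Bu; rewrite ler_piMl.
Qed.

Let cone_cont u (t : R) : {for t, continuous (fun s : R => w + s *: (u - w))}.
Proof. by apply: continuousD; [exact: cst_continuous|exact: scalel_continuous]. Qed.

Let cont01_cone k f u : B u -> (forall y, B y -> {for y, continuous f}) ->
  cont01 (fun t => t ^+ k * f (w + t *: (u - w))).
Proof.
move=> Bu cf; apply: cont01M => t t01; first exact: exprn_continuous.
by apply: continuous_comp; [exact: cone_cont|apply: cf; exact: B_cone].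
Qed.

(** Differentiation under the integral sign. Compactness of [0, 1] makes the continuity of the
    partials uniform along the segment from [w] to [u], so [first_order_bound] holds with one
    constant for all t and can be integrated. *)
Lemma cone_int_diff k f u : B u -> smooth_on B f ->
  differentiable (cone_int k f) u /\
  forall i, partial i (cone_int k f) u = cone_int k.+1 (partial i f) u.
Proof.
move=> Bu sf.
have cs s y : B y -> {for y, continuous (iter_partial s f)}.
  by move=> By; apply/differentiable_continuous/sf.
apply: approx_differentiable => eps eps0.
(* The denominator is N + 1 so that N = 0 is covered; the estimate at the end uses N d <= eps. *)
pose d := eps / (N.+1)%:R.
have d0 : 0 < d by rewrite divr_gt0.
have unif : \forall z \near (0 : E), forall t, t \in `[0, 1]%R ->
    B (w + t *: (u - w) + z) /\ forall i,
    `|partial i f (w + t *: (u - w) + z) - partial i f (w + t *: (u - w))| <= d.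
  have /compact_near_coveringP := @segment_compact R 0 1.
  move=> /(_ _ (nbhs (0 : E)) (fun z t => B (w + t *: (u - w) + z) /\ forall i,
    `|partial i f (w + t *: (u - w) + z) - partial i f (w + t *: (u - w))| <= d)).
  apply => t; rewrite /= in_itv /= => t01.
  pose y0 := w + t *: (u - w).
  have By0 : B y0 by exact: B_cone.
  have c2 : (fun p : R * E => w + p.1 *: (u - w)) @ (nbhs t, nbhs (0 : E)) --> y0.
    apply: (@cvg_comp _ _ _ (fun p : R * E => p.1) (fun s : R => w + s *: (u - w)) _ (nbhs t)).
      exact: cvg_fst.
    exact: cone_cont.
  have c1 : (fun p : R * E => w + p.1 *: (u - w) + p.2) @ (nbhs t, nbhs (0 : E)) --> y0.
    by rewrite -[y0]addr0; apply: cvgD => //; exact: cvg_snd.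
  have close : \forall y \near y0, B y /\
      forall i, `|partial i f y0 - partial i f y| < d / 2.
    apply: filterI; first exact: open_nbhs_nbhs.
    have ci i : \forall y \near y0, `|partial i f y0 - partial i f y| < d / 2.
      by have /cvgr_dist_lt := cs [:: i] y0 By0; apply; rewrite divr_gt0.
    exact: (near_forall ci).
  have C1 : \forall p \near (nbhs t, nbhs (0 : E)), _ := c1 _ close.
  have C2 : \forall p \near (nbhs t, nbhs (0 : E)), _ := c2 _ close.
  apply: filterS2 C1 C2 => - [t' z] /= [Bz cz] [_ cz']; split=> // i.
  rewrite (splitr d) -[X in `|X|](subrKA (partial i f y0)).
  rewrite (le_trans (ler_normD _ _)) // lerD //; last exact/ltW/cz'.
  by rewrite distrC; exact/ltW/cz.
have /nbhs_normP[r r0 Hr] := unif.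
have small : \forall h \near (0 : E), `|h| < r.
  by apply/nbhs_normP; exists r => // h; rewrite /ball_ /= sub0r normrN.
apply: filterS small => h small.
have inr_ (c : R) : 0 <= c <= 1 -> ball_ Num.Def.normr 0 r (c *: h).
  case/andP=> c0 c1; rewrite /ball_ /= sub0r normrN normrZ (ger0_norm c0).
  by apply: le_lt_trans small; rewrite ler_piMl.
have Bhu : B (h + u).
  have [] := Hr h _ 1 _; rewrite ?in_itv /= ?ler01 ?lexx //.
    by rewrite -[h]scale1r; apply: inr_; rewrite ler01 lexx.
  by rewrite scale1r addrC [w + _]addrC subrK.
have cf y : B y -> {for y, continuous f} by exact: (cs [::]).
have cp i y : B y -> {for y, continuous (partial i f)} by exact: (cs [:: i]).
have c1 := @cont01_cone k _ _ Bhu cf; have c2 := @cont01_cone k _ _ Bu cf.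
have c3 i := @cont01_cone k.+1 _ _ Bu (cp i).
have -> : cone_int k f (h + u) - cone_int k f u -
    \sum_i h 0 i * cone_int k.+1 (partial i f) u =
  int01 (fun t => t ^+ k * f (w + t *: (h + u - w)) +
    (-1 * (t ^+ k * f (w + t *: (u - w))) +
     \sum_i (- h 0 i) * (t ^+ k.+1 * partial i f (w + t *: (u - w))))).
  have c4 i := cont01M (@cont01_cst R (- h 0 i)) (c3 i).
  have c5 := cont01M (@cont01_cst R (-1)) c2.
  have c6 := @cont01_sum _ _ (index_enum 'I_N) _ c4.
  rewrite int01D ?int01D ?int01Z ?int01_sum //; last exact: cont01D.
  rewrite mulN1r -addrA -sumrN; congr (_ + (_ + _)); apply: eq_bigr => i _.
  by rewrite int01Z // mulNr.
have Nd : N%:R * d <= eps.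
  by rewrite /d mulrCA ler_piMr ?(ltW eps0) // ler_pdivrMr ?ltr0n // mul1r ler_nat.
apply: int01_bound.
  apply: cont01D => //; apply: cont01D; first exact: cont01M (@cont01_cst R _) c2.
  by apply: cont01_sum => i; exact: cont01M (@cont01_cst R _) (c3 i).
move=> t t01; pose y := w + t *: (u - w).
have -> : w + t *: (h + u - w) = t *: h + y by rewrite -addrA scalerDr addrCA.
rewrite -/y.
have -> : t ^+ k * f (t *: h + y) + (-1 * (t ^+ k * f y) +
    \sum_i - h 0 i * (t ^+ k.+1 * partial i f y)) =
    t ^+ k * (f (t *: h + y) - f y - \sum_i (t *: h) 0 i * partial i f y).
  rewrite !mulrBr mulN1r -addrA mulr_sumr -sumrN; congr (_ + (_ + _)).
  by apply: eq_bigr => i _; rewrite mxE exprSr; ring.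
have t0 : 0 <= t by case/andP: t01.
have t1 : t <= 1 by case/andP: t01.
rewrite normrM normrX (ger0_norm t0).
have st (s : R) : 0 <= s <= 1 -> 0 <= s * t <= 1.
  by case/andP=> s0 s1; rewrite mulr_ge0 // mulr_ile1.
apply: le_trans (_ : N%:R * d * `|t *: h| <= _); last first.
  rewrite normrZ (ger0_norm t0) mulrA ler_wpM2r // -[leRHS]mulr1 ler_pM // ?mulr_ge0 // ltW //.
apply: (@le_trans _ _ (1 * (N%:R * d * `|t *: h|))); last by rewrite mul1r.
apply: ler_pM => //; [exact: exprn_ge0|exact: exprn_ile1|].
apply: first_order_bound => [s s01|s i s01].
  rewrite scalerA; apply: (sf _ [::]).
  by have [] := Hr _ (inr_ _ (st s s01)) t; rewrite ?in_itv.
rewrite scalerA.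
by have [|_ ] := Hr _ (inr_ _ (st s s01)) t; rewrite ?in_itv.
Qed.

End Hadamard.

(** The witness [h i] is [cone_int w 0 (partial i g)]: integrating the derivative of g along the
    segment from [w] to [u] gives the expansion, and at [u = w] the integrand is constant.
    Smoothness holds because cone integrals of smooth functions differentiate to cone integrals. *)
Lemma hadamard (R : realType) (N : nat) (w : 'rV[R]_N) (g : 'rV[R]_N -> R) :
  smooth_at g w -> exists h : 'I_N -> 'rV[R]_N -> R,
  [/\ forall i, smooth_at (h i) w, forall i, h i w = partial i g w &
      \forall u \near w, g u = g w + \sum_i (u 0 i - w 0 i) * h i u].
Proof.
move=> /smooth_atP[D [oD Dw sgD]].
have /nbhs_normP[e e0 He] : nbhs w D by exact: open_nbhs_nbhs.
pose B : set 'rV[R]_N := [set y | `|y - w| < e].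
have sg : smooth_on B g.
  by move=> y s By; apply: sgD; apply: He; rewrite /ball_ /= distrC.
have oB : open B.
  rewrite (_ : B = ball w e); first exact: ball_open.
  by rewrite -ball_normE; apply/seteqP; split=> y; rewrite /ball_ /B /= distrC.
have Bw : B w by rewrite /B /= subrr normr0.
exists (fun i => cone_int w 0 (partial i g)); split=> [i|i|].
- apply: (smooth_on_nbhs oB Bw).
  apply: (@gen_alg_smooth _ _ [set h | exists k f, smooth_on B f /\ h = cone_int w k f]) => //.
  + by move=> _ y [k [f [sf ->]]] By; have [] := cone_int_diff k By sf.
  + move=> _ j [k [f [sf ->]]]; exists (cone_int w k.+1 (partial j f)).
      by apply: GenIn; exists k.+1, (partial j f); split=> //; exact: smooth_on_partial.
    by move=> y By; have [_ ->] := cone_int_diff k By sf.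
  + by apply: GenIn; exists 0%N, (partial i g); split=> //; exact: smooth_on_partial.
- rewrite /cone_int -[RHS]int01_cst; apply: eq_int01 => t _.
  by rewrite subrr scaler0 addr0 mul1r.
- apply: filterS (open_nbhs_nbhs (conj oB Bw)) => u Bu.
  have Bt t : 0 <= t <= 1 -> B (w + t *: (u - w)).
    case/andP=> t0 t1; rewrite /B /= addrAC subrr add0r normrZ ger0_norm //.
    by apply: le_lt_trans Bu; rewrite ler_piMl.
  have ci i : cont01 (fun t => (u 0 i - w 0 i) * (t ^+ 0 * partial i g (w + t *: (u - w)))).
    apply: cont01M; first exact: cont01_cst.
    apply: cont01M => t t01; first exact: cst_continuous.
    apply: continuous_comp.
      by apply: continuousD; [exact: cst_continuous|exact: scalel_continuous].
    by apply/differentiable_continuous/(sg _ [:: i])/Bt.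
  have ci0 i : cont01 (fun t => t ^+ 0 * partial i g (w + t *: (u - w))).
    apply: cont01M => t t01; first exact: cst_continuous.
    apply: continuous_comp.
      by apply: continuousD; [exact: cst_continuous|exact: scalel_continuous].
    by apply/differentiable_continuous/(sg _ [:: i])/Bt.
  under eq_bigr do rewrite /cone_int -int01Z //.
  have -> : g u = g w + (g (w + 1 *: (u - w)) - g (w + 0 *: (u - w))).
    by rewrite scale1r scale0r addr0 addrCA subrr addr0 addrC subrK.
  rewrite -int01_sum //; congr (_ + _); symmetry.
  apply: (@int01_FTC _ (fun t => g (w + t *: (u - w)))); first exact: cont01_sum.
  move=> t t01; apply: is_derive_eq (is_derive_ray (sg _ [::] (Bt t t01))) _.
  by apply: eq_bigr => i _; rewrite !mxE mul1r.
Qed.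

(** * The Riccati recursion *)

Section Recursion.
Variable N : nat.
Implicit Types J : seq 'I_N.

(* Coefficients, indexed by words, of the solution of the Riccati equation
   (b + 1) D_b = K_b + \sum_(0 < p < b) (K_p - D_p) D_(b-p) in noncommuting
   variables; [m] bounds the length of the word. *)
Fixpoint riccati_coef (S : comNzRingType) (kappa : nat -> S)
    (K : 'I_N -> 'I_N -> seq 'I_N -> S) (m : nat) (j i : 'I_N) J : S :=
  if m is m'.+1 then
    kappa (size J) * (K j i J + \sum_(p < size J | (0 < p)%N) \sum_k
      (K j k (take p J) - riccati_coef kappa K m' j k (take p J)) *
        riccati_coef kappa K m' k i (drop p J))
  else 0.

(** Links the recursion in the polynomial ring to the one in [R]. The words are bounded by [a]
    because the ring has indeterminates for bounded degrees only; cutting a word never lengthens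
    it. *)
Lemma riccati_coef_morph (S S' : comNzRingType) (phi : {rmorphism S -> S'})
    (kappa : nat -> S) (kappa' : nat -> S')
    (K : 'I_N -> 'I_N -> seq 'I_N -> S) (K' : 'I_N -> 'I_N -> seq 'I_N -> S') m a :
  (forall b, phi (kappa b) = kappa' b) ->
  (forall j i J, (size J <= a)%N -> phi (K j i J) = K' j i J) ->
  forall j i J, (size J <= a)%N ->
  phi (riccati_coef kappa K m j i J) = riccati_coef kappa' K' m j i J.
Proof.
move=> Hk HK; elim: m => [|m IH] j i J Ja /=; first exact: rmorph0.
rewrite rmorphM rmorphD Hk HK // rmorph_sum; congr (_ * (_ + _)).
apply: eq_bigr => p _; rewrite rmorph_sum; apply: eq_bigr => k _.
have tJ : (size (take p J) <= a)%N.
  by rewrite size_take; case: ifP => // /ltnW pJ; exact: leq_trans Ja.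
have dJ : (size (drop p J) <= a)%N by rewrite size_drop (leq_trans (leq_subr _ _)).
by rewrite rmorphM rmorphB HK // !IH.
Qed.

(** The truncated predecessor also covers a zero factor, whose size is 0. *)
Lemma msizeM_pred (R : realType) (v : nat) (p q : mpoly v R) :
  (mmeasure mdeg (p * q) <= (mmeasure mdeg p + mmeasure mdeg q).-1)%N.
Proof.
have [->|p0] := eqVneq p 0; first by rewrite mul0r mmeasure0.
have [->|q0] := eqVneq q 0; first by rewrite mulr0 mmeasure0.
by rewrite msizeM.
Qed.

(** A cut at p gives factors of degree at most p and |J| - p, so the bound by the length passes to
    products. *)
Lemma riccati_coef_msize (R : realType) (v : nat) (kappa : nat -> R)
    (K : 'I_N -> 'I_N -> seq 'I_N -> mpoly v R) m :
  (forall j i J, (mmeasure mdeg (K j i J) <= (size J).+1)%N) ->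
  forall j i J,
  (mmeasure mdeg (riccati_coef (fun b => mpolyC v (kappa b)) K m j i J)
    <= (size J).+1)%N.
Proof.
move=> HK; elim: m => [|m IH] j i J /=; first by rewrite mmeasure0.
apply: leq_trans (msizeM_pred _ _) _; rewrite msizeC.
have aux (T : finType) (P : pred T) (f : T -> mpoly v R) c :
    (forall t, P t -> (mmeasure mdeg (f t) <= c)%N) ->
    (mmeasure mdeg (\sum_(t | P t) f t) <= c)%N.
  move=> fc; elim/big_ind: _ => //; first by rewrite mmeasure0.
  by move=> x y xc yc; rewrite (leq_trans (msizeD_le _ _)) // geq_max xc.
set s := mmeasure mdeg (_ + _).
(* A constant has size 0 or 1, so multiplication by [kappa] does not raise the bound. *)
suff sJ : (s <= (size J).+1)%N by case: (kappa _ != 0) => /=; lia.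
rewrite /s (leq_trans (msizeD_le _ _)) // geq_max HK /=.
apply: (aux) => p p0; apply: (aux) => k _.
apply: leq_trans (msizeM_pred _ _) _.
have H1 : (mmeasure mdeg (K j k (take p J) -
    riccati_coef (fun b => mpolyC v (kappa b)) K m j k (take p J)) <= p.+1)%N.
  have st : size (take p J) = p by rewrite size_takel // ltnW.
  rewrite (leq_trans (msizeD_le _ _)) // geq_max mmeasureN -{2}st -{4}st.
  by rewrite HK IH.
have H2 := IH k i (drop p J); rewrite size_drop in H2.
(* Sizes exceed degrees by one: (p + 1) + (|J| - p + 1) - 1 = |J| + 1. *)
have := leq_add H1 H2; rewrite addSn addnS subnKC ?(ltnW (ltn_ord p)) //.
by move=> H; rewrite -subn1 leq_subLR add1n.
Qed.

Section Evaluation.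
Variables (R : realType) (u : 'rV[R]_N).

Definition word_part b (f : seq 'I_N -> R) : R :=
  \sum_(J : b.-tuple 'I_N) f J * upow u J.

(** Cutting at p is a bijection from words of length [b] to pairs of words of lengths p and b - p,
    and [upow] is multiplicative under concatenation. *)
Lemma word_part_conv p b (f g : seq 'I_N -> R) : (p <= b)%N ->
  word_part b (fun J => f (take p J) * g (drop p J)) =
  word_part p f * word_part (b - p) g.
Proof.
rewrite /word_part; elim: p b f => [|p IH] b f.
  move=> _; rewrite (sum_tuple0 (fun J => f J * upow u J)) subn0 mulr_sumr.
  apply: eq_bigr => J _.
  by rewrite take0 drop0 /upow big_nil mulr1 mulrA.
case: b => // b pb.
rewrite (sum_tupleS b (fun J => f (take p.+1 J) * g (drop p.+1 J) * upow u J)).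
rewrite (sum_tupleS p (fun J => f J * upow u J)) subSS mulr_suml.
apply: eq_bigr => k _ /=.
under eq_bigr do rewrite upow_cons mulrCA.
rewrite -[LHS]mulr_sumr (IH b (fun J => f (k :: J))) // mulrA; congr (_ * _).
by rewrite mulr_sumr; apply: eq_bigr => J _; rewrite upow_cons mulrCA.
Qed.

Lemma riccati_coef_eval (K : 'I_N -> 'I_N -> seq 'I_N -> R) (d : nat -> 'I_N -> 'I_N -> R) :
  (forall j i, d 0%N j i = 0) -> (forall j i, K j i [::] = 0) ->
  (forall b j i, b.+1%:R * d b j i = word_part b (K j i) +
    \sum_k \sum_(p < b.+1) (word_part p (K j k) - d p j k) * d (b - p)%N k i) ->
  forall m b j i, (b <= m)%N ->
  word_part b (riccati_coef (fun b => b.+1%:R^-1) K m j i) = d b j i.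
Proof.
move=> d0 K0 dE; elim=> [|m IH] b j i.
  rewrite leqn0 => /eqP ->; rewrite /word_part.
  by rewrite (sum_tuple0 (fun J => 0 * upow u J)) mul0r d0.
move=> bm; apply: (mulfI (x := b.+1%:R)); first by rewrite pnatr_eq0.
rewrite dE exchange_big /=.
have wK0 j' k' : word_part 0 (K j' k') = 0.
  by rewrite /word_part (sum_tuple0 (fun J => K j' k' J * upow u J)) K0 mul0r.
(* All parts of degree 0 vanish, so p = 0 and p = b drop out. The two pieces of the remaining cuts
   are shorter than [b], hence within the induction bound [m]. *)
have -> : \sum_(p < b.+1) \sum_k (word_part p (K j k) - d p j k) * d (b - p)%N k i =
    \sum_(p < b | (0 < p)%N) \sum_k (word_part p (K j k) - d p j k) * d (b - p)%N k i.
  rewrite big_ord_recr /= subnn [X in _ + X]big1 ?addr0 => [|k _]; last by rewrite d0 mulr0.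
  rewrite [RHS]big_mkcond; apply: eq_bigr => -[[|p] pb] _ //=.
  by rewrite big1 // => k _; rewrite wK0 d0 subrr mul0r.
rewrite {1}/word_part mulr_sumr.
rewrite (eq_bigr (fun J : b.-tuple 'I_N => (K j i J + \sum_(p < b | (0 < p)%N) \sum_k
      (K j k (take p J) - riccati_coef (fun b => b.+1%:R^-1) K m j k (take p J)) *
        riccati_coef (fun b => b.+1%:R^-1) K m k i (drop p J)) * upow u J)); last first.
  move=> J _ /=; rewrite mulrA size_tuple; congr (_ * _).
  by rewrite mulrA divff ?pnatr_eq0 // mul1r.
under eq_bigr do rewrite mulrDl mulr_suml.
rewrite big_split /= -/(word_part b (K j i)); congr (_ + _).
rewrite exchange_big /=; apply: eq_bigr => p p0.
under eq_bigr do rewrite mulr_suml.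
rewrite exchange_big /=; apply: eq_bigr => k _.
have pm : (p <= m)%N by have := ltn_ord p; lia.
have bpm : (b - p <= m)%N by have := ltn_ord p; lia.
rewrite -(IH p j k) // -(IH (b - p)%N k i) //.
have -> : word_part p (K j k) - word_part p (riccati_coef (fun b => b.+1%:R^-1) K m j k) =
    word_part p (fun J => K j k J - riccati_coef (fun b => b.+1%:R^-1) K m j k J).
  by rewrite /word_part -sumrB; apply: eq_bigr => J _; rewrite mulrBl.
by rewrite -(word_part_conv _ _ (ltnW (ltn_ord p))).
Qed.

End Evaluation.

Definition word_mon J : multinom N := Multinom [tuple count_mem l J | l < N].

Lemma mdeg_word_mon J : mdeg (word_mon J) = size J.
Proof.
rewrite mdegE; under eq_bigr do rewrite mnmE.
elim: J => [|k J IH] /=; first by rewrite big1.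
rewrite big_split /= IH (bigD1 k) //= eqxx big1 ?addn0 // => l.
by rewrite eq_sym => /negPf->.
Qed.

Lemma upow_word_mon (R : realType) (u : 'rV[R]_N) J :
  upow u J = \prod_(l < N) u 0 l ^+ word_mon J l.
Proof.
under eq_bigr do rewrite mnmE.
elim: J => [|k J IH] /=; first by rewrite /upow big_nil big1 // => l _; rewrite expr0.
rewrite upow_cons IH; under [RHS]eq_bigr do rewrite exprD.
rewrite big_split /=; congr (_ * _).
rewrite (bigD1 k) //= eqxx expr1 big1 ?mulr1 // => l.
by rewrite eq_sym => /negPf->; rewrite expr0.
Qed.

(** A multinomial coefficient: the number of distinct orderings of the letters of [J]. *)
Definition mon_words J : nat :=
  #|[pred I : (size J).-tuple 'I_N | word_mon I == word_mon J]|.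

Lemma mon_words_gt0 J : (0 < mon_words J)%N.
Proof. by apply/card_gt0P; exists (in_tuple J); rewrite inE. Qed.

Definition mon_sum (R : realType) (F : seq 'I_N -> R) (m : multinom N) : R :=
  \sum_(J : (mdeg m).-tuple 'I_N | word_mon J == m) F J.

Lemma mon_sumE (R : realType) (F : seq 'I_N -> R) m b : mdeg m = b ->
  mon_sum F m = \sum_(J : b.-tuple 'I_N | word_mon J == m) F J.
Proof. by move=> <-. Qed.

Lemma mon_wordsE b (J : b.-tuple 'I_N) :
  mon_words J = #|[pred I : b.-tuple 'I_N | word_mon I == word_mon J]|.
Proof. by rewrite /mon_words; case: J => J /= /eqP <-. Qed.

(** Words with the same monomial have the same [upow], so replacing each of their coefficients by
    the average leaves the polynomial unchanged. This converts data indexed by monomials into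
    coefficients on words. *)
Lemma mon_sum_average (R : realType) (F : seq 'I_N -> R) b (u : 'rV[R]_N) :
  \sum_(J : b.-tuple 'I_N) (mon_words J)%:R^-1 * mon_sum F (word_mon J) * upow u J =
  \sum_(J : b.-tuple 'I_N) F J * upow u J.
Proof.
rewrite (eq_bigr (fun J : b.-tuple 'I_N => \sum_(I : b.-tuple 'I_N | word_mon I == word_mon J)
   (mon_words I)%:R^-1 * (F I * upow u I))); last first.
  move=> J _; rewrite (@mon_sumE _ _ _ b) ?mdeg_word_mon ?size_tuple //.
  rewrite -mulrA mulr_suml mulr_sumr; apply: eq_bigr => I /eqP IJ.
  by rewrite !upow_word_mon IJ mon_wordsE -IJ -mon_wordsE.
rewrite (exchange_big_dep xpredT) //=; apply: eq_bigr => I _.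
rewrite sumr_const (_ : #|_| = mon_words I).
  by rewrite -[LHS]mulr_natl mulrA divff ?mul1r // pnatr_eq0 -lt0n mon_words_gt0.
by rewrite mon_wordsE; apply: eq_card => J; rewrite !inE; exact: eq_sym.
Qed.

Lemma mon_sum_poly (R : realType) (F : seq 'I_N -> R) b (u : 'rV[R]_N) :
  \sum_(m : bmultinom N b.+1 | mdeg m == b) mon_sum F m * \prod_(l < N) u 0 l ^+ m l =
  \sum_(J : b.-tuple 'I_N) F J * upow u J.
Proof.
have bJ (J : b.-tuple 'I_N) : (mdeg (word_mon J) < b.+1)%N.
  by rewrite mdeg_word_mon size_tuple.
rewrite [RHS](partition_big (fun J : b.-tuple 'I_N => BMultinom (bJ J)) (fun m => mdeg m == b)) /=; last first.
  by move=> J _; rewrite mdeg_word_mon size_tuple.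
apply: eq_bigr => m /eqP mb; rewrite (mon_sumE _ mb) mulr_suml.
apply: eq_big => [J|J /eqP <-]; first by rewrite bmeqP.
by rewrite upow_word_mon.
Qed.

End Recursion.

(** * The universal polynomials in the coefficients of the structure functions *)

Section BracketCoef.
Variables (R : realType) (N : nat).

(** Word coefficients of K_j^i: the first letter is the factor u^k, the rest belongs to a Taylor
    part of C^i_kj. The factorial passes from a radial derivative to a Taylor part, and [mon_words]
    shares a coefficient among the orderings of its monomial. *)
Definition bracket_coef (q : 'I_N -> 'I_N -> 'I_N -> multinom N -> R)
    (j i : 'I_N) (J : seq 'I_N) : R :=
  if J is k :: J' then
    (size J')`!%:R^-1 * ((mon_words J')%:R^-1 * q i k j (word_mon J'))
  else 0.

Lemma bracket_coef_taylor (C : 'I_N -> 'I_N -> 'I_N -> 'rV[R]_N -> R) j i b u :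
  word_part u b (bracket_coef (fun i k j => mon_sum (fun J => iter_partial J (C i k j) 0)) j i) =
  if b is b'.+1 then \sum_k u 0 k * taylor_part b' (C i k j) u else 0.
Proof.
rewrite /word_part; case: b => [|b].
  by rewrite (sum_tuple0 (fun J => bracket_coef _ _ _ J * upow u J)) mul0r.
rewrite (sum_tupleS b (fun J => bracket_coef _ _ _ J * upow u J)).
apply: eq_bigr => k _ /=; rewrite /taylor_part -(@mon_sum_average _ _ (fun J => iter_partial J (C i k j) 0)) mulr_sumr mulr_sumr.
by apply: eq_bigr => J _; rewrite size_tuple upow_cons; ring.
Qed.

End BracketCoef.

Section StructurePolynomials.
Variables (R : realType) (n : nat).
Local Notation N := (n + n).+1.

(** The default 0, for monomials of degree above [a], is never reached from words of length at most
    [a]. *)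
Definition coef_indet (a : nat) (i k j : 'I_N) (m : multinom N) : structure_poly R n a :=
  if insub m is Some m' then
    mpolyX R (mnm1 (enum_rank ((i, k, j, m') : coef_var n a)))
  else 0.

Definition bracket_word (a : nat) (j i : 'I_N) (J : seq 'I_N) : structure_poly R n a :=
  if J is k :: J' then
    ((size J')`!%:R^-1 * (mon_words J')%:R^-1 : R) *:
      coef_indet a i k j (word_mon J')
  else 0.

(** The length of [J] suffices as recursion depth; the ring is the one attached to the weight, as
    the theorem demands. *)
Definition frame_poly (j : 'I_(n + n)) (i : 'I_N) (J : seq 'I_N) :
    structure_poly R n (wnorm J) :=
  riccati_coef (fun b => mpolyC _ b.+1%:R^-1) (bracket_word (wnorm J)) (size J)
    (hor j) i J.

Lemma size_le_wnorm (J : seq 'I_N) : (size J <= wnorm J)%N.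
Proof. exact: leq_addr. Qed.

Lemma frame_poly_degree j i J : degree_le (wnorm J) (frame_poly j i J).
Proof.
rewrite /degree_le; apply: (@leq_trans (size J).+1); last by rewrite ltnS size_le_wnorm.
apply: riccati_coef_msize => {}j' {}i [|k J'] /=; first by rewrite mmeasure0.
rewrite (leq_trans (msizeZ_le _ _)) // /coef_indet; case: insubP => [m _ _|_].
  by rewrite msizeX mdeg1.
by rewrite mmeasure0.
Qed.

Lemma frame_poly_eval q j i J : coef_eval (frame_poly j i J) q =
  riccati_coef (fun b => b.+1%:R^-1) (bracket_coef q) (size J) (hor j) i J.
Proof.
rewrite /coef_eval; set v := (X in meval X).
apply: (@riccati_coef_morph _ _ _ (meval v) _ _ _ _ _ (size J)) => // [b|{}j' {}i [|k J'] sJ].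
- exact: mevalC.
- exact: meval0.
- rewrite /= mevalZ -mulrA /coef_indet; do 2!congr (_ * _).
  (* [J'] is shorter than the weight of [J], so its monomial does have an indeterminate. *)
  rewrite insubT /= ?mdeg_word_mon.
    by rewrite ltnS (leq_trans _ (size_le_wnorm J)) // ltnW.
  by move=> H; rewrite mevalXU /v enum_rankK.
Qed.

Lemma radial_coefs_taylor (C : 'I_N -> 'I_N -> 'I_N -> 'rV[R]_N -> R) :
  (forall i j k, smooth_at (C i j k) 0) ->
  radial_coefs C (fun i k j => mon_sum (fun J => iter_partial J (C i k j) 0)).
Proof.
move=> sC i j k b u; rewrite derive1n_ray // mon_sum_poly /taylor_part.
by rewrite mulrA divff ?mul1r // pnatr_eq0 -lt0n fact_gt0.
Qed.

End StructurePolynomials.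

Lemma partial_sum (R : realType) (N : nat) (I : Type) (r : seq I) (f : I -> 'rV[R]_N -> R) k x :
  (forall i, differentiable (f i) x) ->
  partial k (fun y => \sum_(i <- r) f i y) x = \sum_(i <- r) partial k (f i) x.
Proof.
move=> df; have dS s : differentiable (fun y => \sum_(i <- s) f i y) x.
  elim: s => [|i s IH]; first by under eq_fun do rewrite big_nil; exact: differentiable_cst.
  by under eq_fun do rewrite big_cons; exact: differentiableD.
elim: r => [|i r IH].
  by under eq_fun do rewrite big_nil; rewrite big_nil partial_cst.
by under eq_fun do rewrite big_cons; rewrite partialD // IH big_cons.
Qed.

Lemma taylor_partB (R : realType) (N b : nat) (f g : 'rV[R]_N -> R) u :
  smooth_at f 0 -> smooth_at g 0 ->
  taylor_part b (fun y => f y - g y) u = taylor_part b f u - taylor_part b g u.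
Proof.
move=> sf sg; apply/eqP; rewrite -subr_eq opprK; apply/eqP.
rewrite -taylor_partD //; last exact: smoothB.
by congr taylor_part; apply/funext => y; rewrite subrK.
Qed.

Lemma smooth_det (R : realType) (N m : nat) (B : 'rV[R]_N -> 'M[R]_m) x :
  (forall i j, smooth_at (fun y => B y i j) x) -> smooth_at (fun y => \det (B y)) x.
Proof.
move=> sB; apply: smooth_sum => s; apply: smoothZ.
by apply: smooth_prod => i.
Qed.

(** Near [x] the determinant stays nonzero, and there [invmx] is the adjugate divided by the
    determinant. *)
Lemma smooth_invmx (R : realType) (N m : nat) (B : 'rV[R]_N -> 'M[R]_m) x i j :
  (forall i j, smooth_at (fun y => B y i j) x) -> \det (B x) != 0 ->
  smooth_at (fun y => invmx (B y) i j) x.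
Proof.
move=> sB d0; have sd := smooth_det sB.
apply: (@near_eq_smooth _ _ (fun y => (\det (B y))^-1 * cofactor (B y) j i)).
  have nz : \forall y \near x, \det (B y) != 0.
    exact: (cvgr_neq0 _ (smooth_continuous sd)).
  by apply: filterS nz => y By; rewrite /invmx unitmxE unitfE By !mxE.
apply: smoothM; first exact: smoothV.
by apply: smoothZ; apply: smooth_det => k l; under eq_fun do rewrite !mxE.
Qed.

(** * Germs and tangent vectors *)

Section ComplexSmooth.
Variables (R : realType) (N : nat).
Implicit Types (f g : 'rV[R]_N -> R[i]) (x : 'rV[R]_N) (z w : R[i]).

Lemma ReD z w : complex.Re (z + w) = complex.Re z + complex.Re w.
Proof. by case: z w => [a b] [c d]. Qed.

Lemma ImD z w : complex.Im (z + w) = complex.Im z + complex.Im w.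
Proof. by case: z w => [a b] [c d]. Qed.

Lemma ReM z w :
  complex.Re (z * w) = complex.Re z * complex.Re w - complex.Im z * complex.Im w.
Proof. by case: z w => [a b] [c d]. Qed.

Lemma ImM z w :
  complex.Im (z * w) = complex.Re z * complex.Im w + complex.Im z * complex.Re w.
Proof. by case: z w => [a b] [c d]. Qed.

Lemma ReJ z : complex.Re z^* = complex.Re z.
Proof. by case: z. Qed.

Lemma ImJ z : complex.Im z^* = - complex.Im z.
Proof. by case: z. Qed.

Lemma conj_fixed z : z^* = z -> z = (complex.Re z)%:C.
Proof.
case: z => a b [] /= H; congr (_ +i* _).
have : b *+ 2 = 0 by rewrite mulr2n -{1}H addNr.
by move/eqP; rewrite mulrn_eq0 => /eqP.
Qed.

Lemma real_complexM (a b : R) : (a * b)%:C = a%:C * b%:C.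
Proof. exact: (rmorphM (real_complex R)). Qed.

Lemma real_complexD (a b : R) : (a + b)%:C = a%:C + b%:C.
Proof. exact: (rmorphD (real_complex R)). Qed.

Lemma real_complexB (a b : R) : (a - b)%:C = a%:C - b%:C.
Proof. exact: (rmorphB (real_complex R)). Qed.

Lemma real_complex_sum (I : Type) (r : seq I) (h : I -> R) :
  (\sum_(i <- r) h i)%:C = \sum_(i <- r) (h i)%:C.
Proof. exact: (rmorph_sum (real_complex R)). Qed.

Lemma Re_sum (I : Type) (r : seq I) (h : I -> R[i]) :
  complex.Re (\sum_(i <- r) h i) = \sum_(i <- r) complex.Re (h i).
Proof. by elim/big_rec2: _ => // i a b _ <-; rewrite ReD. Qed.

Lemma complex_sum (I : Type) (r : seq I) (a b : I -> R) :
  \sum_(i <- r) (a i +i* b i) = (\sum_(i <- r) a i) +i* (\sum_(i <- r) b i).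
Proof. by elim/big_rec3: _ => // i s t _ _ ->. Qed.

Lemma near_eq_csmooth f g x : {near x, f =1 g} -> csmooth_at f x -> csmooth_at g x.
Proof.
move=> fg [sr si]; split.
  by apply: near_eq_smooth sr; apply: filterS fg => y /= ->.
by apply: near_eq_smooth si; apply: filterS fg => y /= ->.
Qed.

Lemma csmooth_near f x : csmooth_at f x -> \forall y \near x, csmooth_at f y.
Proof. by move=> [/smooth_near sr /smooth_near si]; apply: filterS2 sr si. Qed.

Lemma csmooth_cst z x : csmooth_at (fun=> z) x.
Proof. by split; exact: smooth_cst. Qed.

Lemma csmoothD f g x : csmooth_at f x -> csmooth_at g x ->
  csmooth_at (fun y => f y + g y) x.
Proof.
move=> [fr fi] [gr gi]; split.
  by under eq_fun do rewrite ReD; exact: smoothD.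
by under eq_fun do rewrite ImD; exact: smoothD.
Qed.

Lemma csmoothM f g x : csmooth_at f x -> csmooth_at g x ->
  csmooth_at (fun y => f y * g y) x.
Proof.
move=> [fr fi] [gr gi]; split.
  by under eq_fun do rewrite ReM; apply: smoothB; exact: smoothM.
by under eq_fun do rewrite ImM; apply: smoothD; exact: smoothM.
Qed.

Lemma csmoothJ f x : csmooth_at f x -> csmooth_at (fun y => (f y)^*) x.
Proof.
move=> [fr fi]; split; first by under eq_fun do rewrite ReJ.
by under eq_fun do rewrite ImJ -mulN1r; exact: smoothZ.
Qed.

Lemma cpartial_real i (g : 'rV[R]_N -> R) x :
  cpartial i (fun y => (g y)%:C) x = (partial i g x)%:C.
Proof. by rewrite /cpartial /= partial_cst. Qed.

Lemma near_eq_cpartial i f g x : {near x, f =1 g} -> cpartial i f x = cpartial i g x.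
Proof.
move=> fg; rewrite /cpartial; congr (_ +i* _); apply: near_eq_partial;
by apply: filterS fg => y /= ->.
Qed.

End ComplexSmooth.

Section Germs.
Variables (R : realType) (N : nat) (M : topologicalType) (A : set (chart R N M)).
Hypothesis mfd : oriented_manifold A.
Implicit Types (f g : M -> R[i]) (p : M) (v w : tvec R M).

Lemma near_chart c p (P : set M) : A c -> cdom c p -> (\forall q \near p, P q) ->
  \forall u \near cmap c p, P (cinv c u).
Proof.
move=> Ac cp HP; have cc := mfd_chart mfd Ac.
by have := chart_cont_inv cc cp; apply; rewrite (chart_cancel cc cp).
Qed.

Lemma near_eq_msmooth f g p : {near p, f =1 g} -> msmooth_at A f p -> msmooth_at A g p.
Proof.
move=> fg sf c Ac cp; apply: near_eq_csmooth (sf c Ac cp).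
exact: (near_chart Ac cp fg).
Qed.

Lemma msmooth_cst (z : R[i]) p : msmooth_at A (fun=> z) p.
Proof. by move=> c _ _; exact: csmooth_cst. Qed.

Lemma msmoothD f g p : msmooth_at A f p -> msmooth_at A g p ->
  msmooth_at A (fun q => f q + g q) p.
Proof. by move=> sf sg c Ac cp; apply: csmoothD; [exact: sf|exact: sg]. Qed.

Lemma msmoothM f g p : msmooth_at A f p -> msmooth_at A g p ->
  msmooth_at A (fun q => f q * g q) p.
Proof. by move=> sf sg c Ac cp; apply: csmoothM; [exact: sf|exact: sg]. Qed.

Lemma msmoothZ (z : R[i]) f p : msmooth_at A f p -> msmooth_at A (fun q => z * f q) p.
Proof. by apply: msmoothM; exact: msmooth_cst. Qed.

Lemma msmoothB f g p : msmooth_at A f p -> msmooth_at A g p ->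
  msmooth_at A (fun q => f q - g q) p.
Proof.
move=> sf sg; apply: msmoothD => //.
by under eq_fun do rewrite -mulN1r; exact: msmoothZ.
Qed.

Lemma msmoothJ f p : msmooth_at A f p -> msmooth_at A (fun q => (f q)^*) p.
Proof. by move=> sf c Ac cp; apply: csmoothJ; exact: sf. Qed.

Lemma msmoothJE f p : msmooth_at A (fun q => (f q)^*) p -> msmooth_at A f p.
Proof. by move=> /msmoothJ; under eq_fun do rewrite conjcK. Qed.

Lemma msmooth_sum (I : Type) (r : seq I) (f : I -> M -> R[i]) p :
  (forall i, msmooth_at A (f i) p) -> msmooth_at A (fun q => \sum_(i <- r) f i q) p.
Proof.
move=> sf; elim: r => [|i r IH].
  by under eq_fun do rewrite big_nil; exact: msmooth_cst.
by under eq_fun do rewrite big_cons; exact: msmoothD.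
Qed.

(** Meant for the inverse [F] of the exponential map, which is given through smooth components: they
    make it continuous in a chart, and the chart carries continuity back to M. *)
Lemma msmooth_row_continuous N' (g : M -> 'rV[R]_N') p :
  (forall l, msmooth_at A (fun q => (g q 0 l)%:C) p) -> {for p, continuous g}.
Proof.
move=> sg; have [c Ac cp] := mfd_cover mfd p; have cc := mfd_chart mfd Ac.
have sc : {for cmap c p, continuous (g \o cinv c)}.
  apply/differentiable_continuous/differentiable_row => l.
  by have [/smooth_differentiable] := sg l c Ac cp.
have H : {for p, continuous ((g \o cinv c) \o cmap c)}.
  by apply: continuous_comp; [exact: (chart_cont cc cp)|exact: sc].
have H2 : g @ p --> ((g \o cinv c) \o cmap c) p.
  apply: cvg_trans H; apply: near_eq_cvg.
  have : nbhs p (cdom c) by apply: open_nbhs_nbhs; split=> //; exact: (chart_open_dom cc).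
  by apply: filterS => q cq /=; rewrite (chart_cancel cc cq).
by move: H2; rewrite /= (chart_cancel cc cp).
Qed.

Lemma csmooth_comp (N' : nat) (phi : 'rV[R]_N' -> 'rV[R]_N) (h : 'rV[R]_N -> R[i]) x :
  (forall l, smooth_at (fun z => phi z 0 l) x) ->
  csmooth_at h (phi x) -> csmooth_at (h \o phi) x.
Proof.
move=> sphi [hr hi]; split.
  exact: (smooth_comp (h := fun y => complex.Re (h y))).
exact: (smooth_comp (h := fun y => complex.Im (h y))).
Qed.

Lemma near_cdom c p : A c -> cdom c p -> \forall q \near p, cdom c q.
Proof.
by move=> Ac cp; apply: open_nbhs_nbhs; split=> //; exact: (chart_open_dom (mfd_chart mfd Ac)).
Qed.

(** One chart suffices: near the point, the expression of [f] in another chart is this one composed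
    with a transition map. *)
Lemma msmooth_chart c f p : A c -> cdom c p ->
  csmooth_at (f \o cinv c) (cmap c p) -> msmooth_at A f p.
Proof.
move=> Ac cp sf d Ad dp.
apply: (@near_eq_csmooth _ _ ((f \o cinv c) \o transition d c)).
  apply: filterS (near_chart Ad dp (near_cdom Ac cp)) => u cu /=.
  by rewrite /transition /= (chart_cancel (mfd_chart mfd Ac)).
apply: csmooth_comp; first exact: (mfd_smooth mfd).
by rewrite /transition /= (chart_cancel (mfd_chart mfd Ad)).
Qed.

Lemma msmooth_near f p : msmooth_at A f p -> \forall q \near p, msmooth_at A f q.
Proof.
move=> sf; have [c Ac cp] := mfd_cover mfd p.
have H := chart_cont (mfd_chart mfd Ac) cp (csmooth_near (sf c Ac cp)).
by apply: filterS2 (near_cdom Ac cp) H => q cq; exact: msmooth_chart.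
Qed.

Section Tangent.
Variables (p : M) (v : tvec R M).
Hypothesis tv : ctangent A p v.

Lemma tvecD f g : msmooth_at A f p -> msmooth_at A g p ->
  v (fun q => f q + g q) = v f + v g.
Proof.
move=> sf sg; have := tan_linear tv 1 sf sg; rewrite mul1r => <-.
by congr v; apply/funext => q; rewrite mul1r.
Qed.

Lemma tvec1 : v (fun=> 1) = 0.
Proof.
have := tan_leibniz tv (@msmooth_cst 1 p) (@msmooth_cst 1 p).
rewrite (_ : (fun _ : M => 1 * 1) = fun=> 1); last by apply/funext => q; rewrite mul1r.
rewrite mul1r => H; apply: (addrI (v (fun=> 1))).
by rewrite -H addr0.
Qed.

Lemma tvec0 : v (fun=> 0) = 0.
Proof.
have := tvecD (@msmooth_cst 0 p) (@msmooth_cst 0 p).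
rewrite (_ : (fun _ : M => 0 + 0) = fun=> 0); last by apply/funext => q; rewrite addr0.
by move=> H; apply: (addrI (v (fun=> 0))); rewrite -H addr0.
Qed.

Lemma tvecZ (z : R[i]) f : msmooth_at A f p -> v (fun q => z * f q) = z * v f.
Proof.
move=> sf; have := tan_linear tv z sf (@msmooth_cst 0 p).
by rewrite tvec0 addr0 => <-; congr v; apply/funext => q; rewrite addr0.
Qed.

Lemma tvec_cst (z : R[i]) : v (fun=> z) = 0.
Proof.
have := tvecZ z (@msmooth_cst 1 p); rewrite tvec1 mulr0 => <-.
by congr v; apply/funext => q; rewrite mulr1.
Qed.

Lemma tvecB f g : msmooth_at A f p -> msmooth_at A g p ->
  v (fun q => f q - g q) = v f - v g.
Proof.
move=> sf sg; have := tan_linear tv (-1) sg sf; rewrite mulN1r addrC => <-.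
by congr v; apply/funext => q; rewrite mulN1r addrC.
Qed.

Lemma tvec_sum (I : Type) (r : seq I) (f : I -> M -> R[i]) :
  (forall i, msmooth_at A (f i) p) ->
  v (fun q => \sum_(i <- r) f i q) = \sum_(i <- r) v (f i).
Proof.
move=> sf; elim: r => [|i r IH].
  by under eq_fun do rewrite big_nil; rewrite tvec0 big_nil.
under eq_fun do rewrite big_cons.
by rewrite tvecD ?IH ?big_cons //; exact: msmooth_sum.
Qed.

(* Multiply by the indicator function of the set where [f] and [g] agree. *)
Lemma tvec_near f g : {near p, f =1 g} -> v f = v g.
Proof.
move=> fg; have [sf|nsf] := pselect (msmooth_at A f p); last first.
  rewrite !(tan_junk tv) // => sg; apply: nsf.
  by apply: near_eq_msmooth sg; apply: filterS fg => q ->.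
have sg : msmooth_at A g p := near_eq_msmooth fg sf.
pose chi q : R[i] := if `[< f q = g q >] then 1 else 0.
have chi1 : chi p = 1 by rewrite /chi asboolT //; exact: (nbhs_singleton fg).
have schi : msmooth_at A chi p.
  apply: (near_eq_msmooth _ (@msmooth_cst 1 p)).
  by apply: filterS fg => q fgq; rewrite /chi asboolT.
have vchi : v chi = 0.
  have := tan_leibniz tv schi schi; rewrite chi1 !mul1r.
  rewrite (_ : (fun q => chi q * chi q) = chi); last first.
    by apply/funext => q; rewrite /chi; case: ifP; rewrite ?mulr1 ?mulr0.
  by move=> H; apply: (addrI (v chi)); rewrite -H addr0.
have E h : msmooth_at A h p -> v (fun q => h q * chi q) = v h.
  by move=> sh; rewrite (tan_leibniz tv) // vchi chi1 mulr0 add0r mul1r.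
rewrite -(E f) // -(E g) //; congr v; apply/funext => q; rewrite /chi.
by case: asboolP => [->|]; rewrite ?mulr0.
Qed.

Lemma ctangentJ : ctangent A p (conjv v).
Proof.
split=> [z f g sf sg|f g sf sg|f nsf]; rewrite /conjv.
- rewrite -[in RHS](conjcK z) -rmorphM -rmorphD; congr (_ ^*).
  rewrite -(tan_linear tv); [|exact: msmoothJ|exact: msmoothJ].
  by congr v; apply/funext => q; rewrite rmorphD rmorphM.
- rewrite -[in RHS](conjcK (f p)) -[in RHS](conjcK (g p)) -!rmorphM -rmorphD.
  congr (_ ^*); rewrite -(tan_leibniz tv); [|exact: msmoothJ|exact: msmoothJ].
  by congr v; apply/funext => q; rewrite rmorphM.
- by rewrite (tan_junk tv) ?rmorph0 // => /msmoothJE.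
Qed.

End Tangent.

Lemma ctangent_lin p v w (a b : R[i]) : ctangent A p v -> ctangent A p w ->
  ctangent A p (fun f => a * v f + b * w f).
Proof.
move=> tv tw; split=> [z f g sf sg|f g sf sg|f nsf].
- by rewrite (tan_linear tv) // (tan_linear tw) //; ring.
- by rewrite (tan_leibniz tv) // (tan_leibniz tw) //; ring.
- by rewrite (tan_junk tv) // (tan_junk tw) // !mulr0 addr0.
Qed.

Lemma smooth_vfJ (D : set M) (V : vfield R M) : smooth_vf A D V -> smooth_vf A D (conjvf V).
Proof.
move=> [tV sV]; split=> [p Dp|p f Dp sf]; first exact/ctangentJ/tV.
by apply: msmoothJ; apply: sV => //; exact: msmoothJ.
Qed.

Lemma smooth_vf_lin (D : set M) (V V' : vfield R M) (a b : R[i]) :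
  smooth_vf A D V -> smooth_vf A D V' ->
  smooth_vf A D (fun p f => a * V p f + b * V' p f).
Proof.
move=> [tV sV] [tV' sV']; split=> [p Dp|p f Dp sf].
  by apply: ctangent_lin; [exact: tV|exact: tV'].
by apply: msmoothD; apply: msmoothZ; [exact: sV|exact: sV'].
Qed.

(** The mixed products of first derivatives cancel in the commutator. Linearity and Leibniz for the
    inner field hold only at points near p, so [tvec_near] is needed before the outer vector can be
    applied. *)
Lemma lie_tangent (D : set M) (V V' : vfield R M) p : open D -> D p ->
  smooth_vf A D V -> smooth_vf A D V' -> ctangent A p (lie A V V' p).
Proof.
move=> oD Dp [tV sV] [tV' sV'].
have tp := tV p Dp; have tp' := tV' p Dp.
have nD : \forall q \near p, D q by exact: open_nbhs_nbhs.
split=> [z f g sf sg|f g sf sg|f nsf]; last by rewrite /lie asboolF.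
- rewrite /lie !asboolT //; last by apply: msmoothD => //; exact: msmoothZ.
  have E (X : vfield R M) : (forall q, D q -> ctangent A q (X q)) ->
      {near p, (fun q => X q (fun q => z * f q + g q)) =1 (fun q => z * X q f + X q g)}.
    move=> tX; apply: filterS3 nD (msmooth_near sf) (msmooth_near sg) => q Dq.
    by move=> sfq sgq; rewrite (tan_linear (tX q Dq)).
  rewrite (tvec_near tp (E V' tV')) (tvec_near tp' (E V tV)).
  have [fV gV] := (sV _ _ Dp sf, sV _ _ Dp sg).
  have [fV' gV'] := (sV' _ _ Dp sf, sV' _ _ Dp sg).
  by rewrite (tan_linear tp) // (tan_linear tp') //; ring.
- rewrite /lie !asboolT //; last exact: msmoothM.
  have E (X : vfield R M) : (forall q, D q -> ctangent A q (X q)) ->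
      {near p, (fun q => X q (fun q => f q * g q)) =1 (fun q => f q * X q g + g q * X q f)}.
    move=> tX; apply: filterS3 nD (msmooth_near sf) (msmooth_near sg) => q Dq.
    by move=> sfq sgq; rewrite (tan_leibniz (tX q Dq)).
  rewrite (tvec_near tp (E V' tV')) (tvec_near tp' (E V tV)).
  have [fV gV] := (sV _ _ Dp sf, sV _ _ Dp sg).
  have [fV' gV'] := (sV' _ _ Dp sf, sV' _ _ Dp sg).
  rewrite (tvecD tp); [|exact: msmoothM..].
  rewrite (tvecD tp'); [|exact: msmoothM..].
  by rewrite !(tan_leibniz tp) // !(tan_leibniz tp') //; ring.
Qed.

End Germs.

(** * Exponential coordinates *)

Section ExpCoordinates.
Variables (R : realType) (N : nat) (M : topologicalType) (A : set (chart R N M)).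
Variables (W : set M) (X : 'I_N -> vfield R M) (x : M) (U : set 'rV[R]_N) (V : set M).
Variables (E : 'rV[R]_N -> M) (F : M -> 'rV[R]_N).
Hypothesis mfd : oriented_manifold A.
Hypothesis oW : open W.
Hypothesis sX : forall j, smooth_vf A W (X j).
Hypothesis rX : forall j p, W p -> realv (X j p).
Hypothesis expE : exp_coordinates A W X x U V E F.
Implicit Types (u : 'rV[R]_N) (i j k l m : 'I_N) (f : M -> R[i]) (v : tvec R M).

Lemma exp_in_V u : U u -> V (E u).
Proof. by move=> /(exp_bij_l expE)[]. Qed.

Lemma exp_cancel u : U u -> F (E u) = u.
Proof. by move=> /(exp_bij_l expE)[]. Qed.

Lemma exp_in_W u : U u -> W (E u).
Proof.
move=> Uu; have [C HC] := exp_curve_ex expE Uu.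
rewrite (exp_curve expE Uu HC); case: HC => _ _ H _; apply: H.
by rewrite in_itv /= ler01 lexx.
Qed.

Lemma near_U u : U u -> \forall y \near u, U y.
Proof. by move=> Uu; apply: open_nbhs_nbhs; split=> //; exact: (exp_open_dom expE). Qed.

Lemma msmooth_comp_inv (h : 'rV[R]_N -> R[i]) p : V p -> csmooth_at h (F p) ->
  msmooth_at A (h \o F) p.
Proof.
move=> Vp sh c Ac cp; apply: (csmooth_comp (phi := F \o cinv c)).
  by move=> l; have [] := exp_smooth_inv expE l Vp Ac cp.
by rewrite /= (chart_cancel (mfd_chart mfd Ac)).
Qed.

Definition coordf l : M -> R[i] := fun q => (F q 0 l)%:C.

Lemma coordf_smooth l p : V p -> msmooth_at A (coordf l) p.
Proof. exact: (exp_smooth_inv expE). Qed.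

Lemma inv_continuous p : V p -> {for p, continuous F}.
Proof. by move=> Vp; apply: (msmooth_row_continuous mfd) => l; exact: coordf_smooth. Qed.

(** Hadamard's lemma for [f \o E], pulled back by [F], writes f near [E u] as a constant plus a sum
    of (coordf l - u^l) h_l. The derivation kills the constant; as coordf l - u^l vanishes at the
    point, Leibniz leaves v(coordf l) h_l(u), and h_l(u) is the partial derivative. *)
Lemma tangent_coords u v f : U u -> ctangent A (E u) v -> msmooth_at A f (E u) ->
  v f = \sum_l v (coordf l) * cpartial l (f \o E) u.
Proof.
move=> Uu tv sf; have Vp := exp_in_V Uu.
have [/hadamard[hr [shr hru Hr]] /hadamard[hi [shi hiu Hi]]] := exp_smooth expE Uu sf.
pose h l y : R[i] := (hr l y) +i* (hi l y).
have sh l : csmooth_at (h l) u by split; [exact: shr|exact: shi].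
pose g q := f (E u) + \sum_l (coordf l q - (u 0 l)%:C) * (h l \o F) q.
have fg : {near (E u), f =1 g}.
  have cF := inv_continuous Vp; have Vn : \forall q \near E u, V q.
    by apply: open_nbhs_nbhs; split=> //; exact: (exp_open_im expE).
  have Hn : \forall y \near u, f (E y) = f (E u) + \sum_l ((y 0 l)%:C - (u 0 l)%:C) * h l y.
    apply: filterS2 Hr Hi => y /=.
    case: (f (E y)) => a b; case: (f (E u)) => a' b' /= -> ->.
    have -> : \sum_l ((y 0 l)%:C - (u 0 l)%:C) * h l y =
       (\sum_l (y 0 l - u 0 l) * hr l y) +i* (\sum_l (y 0 l - u 0 l) * hi l y).
      rewrite -complex_sum; apply: eq_bigr => l _; rewrite -real_complexB.
      by apply/eqP; rewrite eq_complex ReM ImM /= !mul0r subr0 addr0 !eqxx.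
    by [].
  have Hn' : \forall q \near E u, f (E (F q)) = f (E u) +
      \sum_l ((F q 0 l)%:C - (u 0 l)%:C) * h l (F q).
    have cFu : F @ E u --> u by rewrite -[X in _ --> X](exp_cancel Uu).
    exact: cFu _ Hn.
  by apply: filterS2 Vn Hn' => q Vq; have [_ ->] := exp_bij_r expE Vq.
have sF l := coordf_smooth l Vp.
have sFc l : msmooth_at A (fun q => coordf l q - (u 0 l)%:C) (E u).
  by apply: msmoothB => //; exact: msmooth_cst.
have shF l : msmooth_at A (h l \o F) (E u).
  by apply: msmooth_comp_inv => //; rewrite exp_cancel.
rewrite (tvec_near mfd tv fg) /g (tvecD tv).
- rewrite (tvec_cst tv) add0r (tvec_sum tv); last by move=> l; exact: msmoothM.
  apply: eq_bigr => l _; rewrite (tan_leibniz tv) //.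
  rewrite {1}/coordf exp_cancel // subrr mul0r add0r (tvecB tv) //; last exact: msmooth_cst.
  rewrite (tvec_cst tv) subr0 mulrC; congr (_ * _).
  by rewrite /= exp_cancel // /cpartial -hru -hiu.
- exact: msmooth_cst.
- by apply: msmooth_sum => l; exact: msmoothM.
Qed.

(** The entry A_j^l of the frame matrix. The real part loses nothing on [U], where the frame fields
    are real. *)
Definition frame_coef j l u : R := complex.Re (X j (E u) (coordf l)).

Lemma frame_coefE j l u : U u -> X j (E u) (coordf l) = (frame_coef j l u)%:C.
Proof.
move=> Uu; apply: conj_fixed; have := rX j (exp_in_W Uu); rewrite /realv => /(congr1 (fun v => v (coordf l))).
by rewrite /conjv; under eq_fun do rewrite conjc_real.
Qed.

Lemma frame_coef_csmooth j l u : U u ->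
  csmooth_at ((fun q => X j q (coordf l)) \o E) u.
Proof.
move=> Uu; apply: (exp_smooth expE) => //; have [_ H] := sX j.
by apply: H; [exact: exp_in_W|exact/coordf_smooth/exp_in_V].
Qed.

Lemma frame_coef_smooth j l u : U u -> smooth_at (frame_coef j l) u.
Proof. by move=> /(frame_coef_csmooth j l)[]. Qed.

Lemma frame_coords j u f : U u -> msmooth_at A f (E u) ->
  X j (E u) f = \sum_l (frame_coef j l u)%:C * cpartial l (f \o E) u.
Proof.
move=> Uu sf; have [tX _] := sX j.
rewrite (tangent_coords Uu (tX _ (exp_in_W Uu)) sf).
by apply: eq_bigr => l _; rewrite frame_coefE.
Qed.

Lemma frame_coord_vec j u : U u ->
  X j (E u) = fun f => \sum_l (frame_coef j l u)%:C * coord_vec A E l u f.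
Proof.
move=> Uu; apply/funext => f; rewrite /coord_vec; case: asboolP => sf.
  exact: frame_coords.
have [tX _] := sX j; rewrite (tan_junk (tX _ (exp_in_W Uu))) // big1 // => l _.
by rewrite mulr0.
Qed.

(** Both sides are the value of [X_j, X_k] on the coordinate function of index l. *)
Lemma frame_bracket (C : 'I_N -> 'I_N -> 'I_N -> 'rV[R]_N -> R) j k l u :
  structure_functions A X U E C -> U u ->
  \sum_i C i j k u * frame_coef i l u =
  \sum_m (frame_coef j m u * partial m (frame_coef k l) u -
          frame_coef k m u * partial m (frame_coef j l) u).
Proof.
move=> HC Uu; have := congr1 (fun v => v (coordf l)) (HC u j k Uu).
have sl := coordf_smooth l (exp_in_V Uu).
have D j' k' : X j' (E u) (fun q => X k' q (coordf l)) =
    (\sum_m frame_coef j' m u * partial m (frame_coef k' l) u)%:C.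
  rewrite frame_coords //; last first.
    by have [_ H] := sX k'; apply: H => //; exact: exp_in_W.
  rewrite real_complex_sum; apply: eq_bigr => m _; rewrite real_complexM; congr (_ * _).
  rewrite -cpartial_real; apply: near_eq_cpartial.
  by apply: filterS (near_U Uu) => y Uy /=; exact: frame_coefE.
rewrite /lie asboolT // !D /lincomb => H.
apply: complexI; rewrite sumrB real_complexB H real_complex_sum.
by apply: eq_bigr => i _; rewrite real_complexM frame_coefE.
Qed.

(** Chain rule for t -> s t: s <= 1 keeps the times in [0, 1], and s > 0 sends punctured
    neighbourhoods to punctured ones. *)
Lemma exp_curve_rescale u (C : R -> M) (s : R) : 0 < s <= 1 ->
  integral_curve A W (fun p => lincomb (fun j => (u 0 j)%:C) (fun j => X j p)) x C ->
  integral_curve A W (fun p => lincomb (fun j => ((s *: u) 0 j)%:C) (fun j => X j p)) x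
    (fun t => C (s * t)).
Proof.
move=> /andP[s0 s1] [C0 Cc CW Cd].
have st (t : R) : t \in `[0, 1]%R -> s * t \in `[0, 1]%R.
  rewrite !in_itv /= => /andP[t0 t1].
  by rewrite mulr_ge0 ?(ltW s0) // mulr_ile1 // ltW.
have sc (t : R) : {for t, continuous ( *%R s)} by exact: mulrl_continuous.
split; first by rewrite mulr0.
- apply/subspace_continuousP => t t01.
  have /subspace_continuousP /(_ (s * t) (st t t01)) H := Cc.
  move=> P /H; rewrite /= !nbhs_simpl /= /within /= => HP.
  have : \forall y \near t, `[0, 1]%classic (s * y) -> P (C (s * y)) := sc t _ HP.
  apply: filterS => y /= Hy y01.
  exact/Hy/st.
- by move=> t t01; apply/CW/st.
- move=> t f t01 sf; have H := Cd (s * t) f (st t t01) sf.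
  have -> : complex.Re (lincomb (fun j => ((s *: u) 0 j)%:C) (fun j => X j (C (s * t)))
      (fun q => (f q)%:C)) = s * complex.Re (lincomb (fun j => (u 0 j)%:C)
      (fun j => X j (C (s * t))) (fun q => (f q)%:C)).
    rewrite /lincomb !Re_sum mulr_sumr; apply: eq_bigr => j _.
    by rewrite !ReM /= mxE !mul0r !subr0 mulrA.
  have K : (s * y - s * t)^-1 * (f (C (s * y)) - f (C (s * t))) @[y --> within `[0, 1] t^'] -->
      complex.Re (lincomb (fun j => (u 0 j)%:C)
      (fun j => X j (C (s * t))) (fun q => (f q)%:C)).
    move=> P /H; rewrite /= !nbhs_simpl /= /within /dnbhs /within /= => HP.
    have : \forall y \near t, s * y != s * t -> `[0, 1]%classic (s * y) ->
        P ((s * y - s * t)^-1 * (f (C (s * y)) - f (C (s * t)))) := sc t _ HP.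
    apply: filterS => y /= Hy yt y01.
    apply: Hy; last exact: st.
    by apply: contra_neq yt => /(mulfI (lt0r_neq0 s0)).
  have -> : (fun y => (y - t)^-1 * (f (C (s * y)) - f (C (s * t)))) =
      (fun y => s * ((s * y - s * t)^-1 * (f (C (s * y)) - f (C (s * t))))).
    by apply/funext => y; rewrite -mulrBr invfM mulrA mulrA divff ?mul1r // lt0r_neq0.
  by apply: cvgM => //; exact: cvg_cst.
Qed.

(** By rescaling, the curve of [u] is at E(s u) at time s, so its coordinates there are s u. Their
    left derivative at s = 1 is [u], and by the curve equation it is also the value of the field on
    the coordinates. *)
Lemma frame_euler l u : U u -> \sum_j u 0 j * frame_coef j l u = u 0 l.
Proof.
move=> Uu; have [C HC] := exp_curve_ex expE Uu.
have EC := exp_curve expE Uu HC; have [_ _ _ Cd] := HC.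
have one01 : 1 \in `[0, 1 : R]%R by rewrite in_itv /= ler01 lexx.
have sl : msmooth_at A (fun q => (F q 0 l)%:C) (C 1).
  by rewrite -EC; apply: coordf_smooth; exact: exp_in_V.
have := Cd 1 (fun q => F q 0 l) one01 sl; rewrite /= -EC.
have -> : complex.Re (lincomb (fun j => (u 0 j)%:C) (fun j => X j (E u))
    (fun q => (F q 0 l)%:C)) = \sum_j u 0 j * frame_coef j l u.
  by rewrite /lincomb Re_sum; apply: eq_bigr => j _; rewrite ReM /= mul0r subr0.
move=> L1.
have L2 : (s - 1)^-1 * (F (C s) 0 l - F (E u) 0 l) @[s --> (1 : R)^'-] -->
    \sum_j u 0 j * frame_coef j l u.
  apply: cvg_trans L1; apply: cvg_app => P.
  move=> HP; have {}HP : \forall y \near (1 : R), y != 1 -> `[0, 1]%classic y -> P y := HP.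
  (* Close to 1, where s is positive, the punctured trace of [0, 1] is a left neighbourhood. *)
  suff : \forall y \near (1 : R), y < 1 -> P y by [].
  have pos : \forall s \near (1 : R), 0 < s by exact: lt_nbhsr.
  apply: filterS2 pos HP => s s0 Hs s1; apply: Hs; first by rewrite lt_eqF.
  by rewrite /= in_itv /= !ltW.
have L3 : (s - 1)^-1 * (F (C s) 0 l - F (E u) 0 l) @[s --> (1 : R)^'-] --> u 0 l.
  apply: cvg_near_cst.
  have pos : \forall s \near (1 : R), 0 < s by exact: lt_nbhsr.
  have inU : \forall s \near (1 : R), U (s *: u).
    have : (fun s : R => s *: u) @ (1 : R) --> (1 *: u : 'rV[R]_N).
      exact: scalel_continuous.
    by rewrite scale1r; apply; exact: near_U.
  suff : \forall s \near (1 : R), s < 1 ->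
      (s - 1)^-1 * (F (C s) 0 l - F (E u) 0 l) = u 0 l by [].
  apply: filterS2 pos inU => s s0 Us s1.
  have s01 : 0 < s <= 1 by rewrite s0 ltW.
  have := exp_curve expE Us (exp_curve_rescale s01 HC); rewrite mulr1 => <-.
  rewrite !exp_cancel // mxE -{2}[u 0 l]mul1r -mulrBl mulrA mulVf ?mul1r //.
  by rewrite subr_eq0 lt_eqF.
exact: (cvg_unique _ L2 L3).
Qed.

(** The partial derivative of index m of the identity in [frame_euler]. *)
Lemma frame_coef_partial m l u : U u ->
  frame_coef m l u + \sum_j u 0 j * partial m (frame_coef j l) u = (m == l)%:R.
Proof.
move=> Uu; rewrite -(partial_coord l m u).
have <- : partial m (fun y => \sum_j y 0 j * frame_coef j l y) u =
    partial m (fun y => y 0 l) u.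
  by apply: near_eq_partial; apply: filterS (near_U Uu) => y /frame_euler.
have dA j : differentiable (frame_coef j l) u by exact/smooth_differentiable/frame_coef_smooth.
have dc j : differentiable (fun y : 'rV[R]_N => y 0 j) u.
  by exact/smooth_differentiable/smooth_coord.
rewrite partial_sum => [|j]; last exact: differentiableM.
under [RHS]eq_bigr do rewrite partialM // partial_coord.
rewrite big_split /= addrC; congr (_ + _).
rewrite (bigD1 m) //= eqxx mulr1 big1 ?addr0 // => j /negPf jm.
by rewrite eq_sym jm mulr0.
Qed.

Lemma frame_coef0 j l : frame_coef j l 0 = (j == l)%:R.
Proof.
rewrite -(frame_coef_partial j l (exp_dom0 expE)) big1 ?addr0 // => k _.
by rewrite mxE mul0r.
Qed.

Section StructureEquation.
Variable C : 'I_N -> 'I_N -> 'I_N -> 'rV[R]_N -> R.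
Hypothesis HC : structure_functions A X U E C.

(** Contract [frame_bracket] with u^j. The first sum becomes the Euler derivative by [frame_euler];
    in the second, [frame_coef_partial] trades derivatives of the frame for the frame itself. *)
Lemma frame_radial k l u : U u ->
  \sum_m u 0 m * partial m (frame_coef k l) u =
  frame_coef k l u + \sum_i (\sum_j u 0 j * C i j k u) * frame_coef i l u -
  \sum_m frame_coef k m u * frame_coef m l u.
Proof.
move=> Uu.
have -> : \sum_i (\sum_j u 0 j * C i j k u) * frame_coef i l u =
    \sum_m u 0 m * partial m (frame_coef k l) u -
    \sum_m frame_coef k m u * \sum_j u 0 j * partial m (frame_coef j l) u.
  under eq_bigr do rewrite mulr_suml.
  rewrite exchange_big /=.
  have -> : \sum_j \sum_i u 0 j * C i j k u * frame_coef i l u =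
      \sum_j u 0 j * \sum_m (frame_coef j m u * partial m (frame_coef k l) u -
          frame_coef k m u * partial m (frame_coef j l) u).
    apply: eq_bigr => j _; rewrite -(frame_bracket _ _ _ HC Uu) mulr_sumr.
    by apply: eq_bigr => i _; rewrite mulrA.
  under [in LHS]eq_bigr do rewrite mulr_sumr.
  rewrite exchange_big -sumrB /=; apply: eq_bigr => m _.
  rewrite -{1}(frame_euler m Uu) mulr_suml mulr_sumr -sumrB.
  by apply: eq_bigr => j _; ring.
have -> : \sum_m frame_coef k m u * \sum_j u 0 j * partial m (frame_coef j l) u =
    frame_coef k l u - \sum_m frame_coef k m u * frame_coef m l u.
  transitivity (\sum_m (frame_coef k m u * (m == l)%:R - frame_coef k m u * frame_coef m l u)).
    apply: eq_bigr => m _; rewrite -mulrBr; congr (_ * _).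
    by rewrite -(frame_coef_partial m l Uu) addrC addKr.
  rewrite sumrB (bigD1 l) //= eqxx mulr1 big1 ?addr0 // => m /negPf ->.
  by rewrite mulr0.
by ring.
Qed.

(** By [frame_bracket] the row of the C^i_jk times the frame matrix is smooth; that matrix is the
    identity at 0, so it can be inverted smoothly nearby. *)
Lemma structure_smooth i j k : smooth_at (C i j k) 0.
Proof.
have U0 := exp_dom0 expE.
pose B u := \matrix_(i, l) frame_coef i l u.
have sB i' l : smooth_at (fun u => B u i' l) 0.
  by under eq_fun do rewrite mxE; exact: frame_coef_smooth.
have B0 : \det (B 0) != 0.
  have -> : B 0 = 1%:M by apply/matrixP => i' l; rewrite !mxE frame_coef0.
  by rewrite det1 oner_eq0.
pose G l u := \sum_m (frame_coef j m u * partial m (frame_coef k l) u -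
          frame_coef k m u * partial m (frame_coef j l) u).
have sG l : smooth_at (G l) 0.
  apply: smooth_sum => m; apply: smoothB; apply: smoothM;
  by [exact: frame_coef_smooth|exact/smooth_partial/frame_coef_smooth].
apply: (@near_eq_smooth _ _ (fun u => \sum_l G l u * invmx (B u) l i)); last first.
  by apply: smooth_sum => l; apply: smoothM => //; exact: smooth_invmx.
have nz : \forall u \near (0 : 'rV[R]_N), \det (B u) != 0.
  exact: (cvgr_neq0 _ (smooth_continuous (smooth_det sB))).
apply: filterS2 (near_U U0) nz => u Uu Bu.
have CB : (\row_i' C i' j k u) *m B u = \row_l G l u.
  apply/rowP => l; rewrite !mxE /G -(frame_bracket _ _ _ HC Uu).
  by apply: eq_bigr => i' _; rewrite !mxE.
have -> : C i j k u = (\row_i' C i' j k u) 0 i by rewrite mxE.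
have Bunit : B u \in unitmx by rewrite unitmxE unitfE.
rewrite -(mulmxK Bunit (\row_i' C i' j k u)) CB mxE.
by apply: eq_bigr => l _; rewrite mxE.
Qed.

Definition frame_dev j i u : R := frame_coef j i u - (j == i)%:R.

Lemma frame_dev_smooth j i : smooth_at (frame_dev j i) 0.
Proof.
apply: smoothB; last exact: smooth_cst.
by apply: frame_coef_smooth; exact: (exp_dom0 expE).
Qed.

Definition contracted j i (u : 'rV[R]_N) : R := \sum_k u 0 k * C i k j u.

Lemma contracted_smooth j i : smooth_at (contracted j i) 0.
Proof.
apply: smooth_sum => k; apply: smoothM; first exact: smooth_coord.
exact: structure_smooth.
Qed.

Lemma frame_riccati j i u : U u ->
  \sum_m u 0 m * partial m (frame_dev j i) u + frame_dev j i u =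
  contracted j i u +
  \sum_k (contracted j k u - frame_dev j k u) * frame_dev k i u.
Proof.
move=> Uu.
have -> : \sum_m u 0 m * partial m (frame_dev j i) u =
    \sum_m u 0 m * partial m (frame_coef j i) u.
  apply: eq_bigr => m _; congr (_ * _); rewrite /frame_dev.
  rewrite (@partialD _ _ m (frame_coef j i) (fun=> - (j == i)%:R)) ?partial_cst ?addr0 //.
  exact/smooth_differentiable/frame_coef_smooth.
rewrite frame_radial // -/(contracted _ _ _).
have delta_l (f : 'I_N -> R) : \sum_m (j == m)%:R * f m = f j.
  rewrite (bigD1 j) //= eqxx mul1r big1 ?addr0 // => m.
  by rewrite eq_sym => /negPf ->; rewrite mul0r.
have delta_r (f : 'I_N -> R) : \sum_m f m * (m == i)%:R = f i.
  rewrite (bigD1 i) //= eqxx mulr1 big1 ?addr0 // => m /negPf ->.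
  by rewrite mulr0.
have -> : \sum_k (contracted j k u - frame_dev j k u) * frame_dev k i u =
   \sum_k contracted j k u * frame_coef k i u
   - \sum_k contracted j k u * (k == i)%:R
   - (\sum_k frame_coef j k u * frame_coef k i u
      - \sum_k frame_coef j k u * (k == i)%:R
      - \sum_k (j == k)%:R * frame_coef k i u
      + \sum_k (j == k)%:R * (k == i)%:R).
  by rewrite -!sumrB -!big_split -sumrB /=; apply: eq_bigr => k _; rewrite /frame_dev; ring.
rewrite !delta_r !delta_l /frame_dev.
rewrite -/(contracted j _ u); under [in LHS]eq_bigr do rewrite -/(contracted j _ u).
by ring.
Qed.

Definition structure_coef i k j : multinom N -> R :=
  mon_sum (fun J => iter_partial J (C i k j) 0).

Lemma contracted_taylor b j i u :
  taylor_part b (contracted j i) u = word_part u b (bracket_coef structure_coef j i).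
Proof.
rewrite bracket_coef_taylor taylor_part_sum; last first.
  by move=> k; apply: smoothM; [exact: smooth_coord|exact: structure_smooth].
case: b => [|b]; first by rewrite big1 // => k _; rewrite taylor_part0 mxE mul0r.
by apply: eq_bigr => k _; rewrite taylor_part_coordM //; exact: structure_smooth.
Qed.

(** In degree b the Euler field multiplies by b and products become convolutions, so the Riccati
    equation turns into the recursion that [riccati_coef_eval] solves. *)
Lemma frame_dev_taylor (m b : nat) j i u : (b <= m)%N ->
  word_part u b (riccati_coef (fun b => b.+1%:R^-1) (bracket_coef structure_coef) m j i) =
  taylor_part b (frame_dev j i) u.
Proof.
apply: (@riccati_coef_eval _ _ u _ (fun b j i => taylor_part b (frame_dev j i) u)) => //.
  by move=> {}j {}i; rewrite taylor_part0 /frame_dev frame_coef0 subrr.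
move=> {}b {}j {}i; rewrite -contracted_taylor.
have sD := frame_dev_smooth; have sK := contracted_smooth.
have sP k : smooth_at (fun u => (contracted j k u - frame_dev j k u) * frame_dev k i u) 0.
  by apply: smoothM => //; exact: smoothB.
have sS : smooth_at (fun u => \sum_k (contracted j k u - frame_dev j k u) * frame_dev k i u) 0.
  exact: smooth_sum.
have sE : smooth_at (fun u => \sum_m u 0 m * partial m (frame_dev j i) u) 0.
  apply: smooth_sum => k; apply: smoothM; first exact: smooth_coord.
  exact: smooth_partial.
rewrite -natr1 mulrDl mul1r -taylor_part_euler // -taylor_partD //.
rewrite (@taylor_part_near _ _ _ _ (fun u => contracted j i u +
    \sum_k (contracted j k u - frame_dev j k u) * frame_dev k i u)); last first.
  by apply: filterS (near_U (exp_dom0 expE)) => y; exact: frame_riccati.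
rewrite (@taylor_partD _ _ b (contracted j i)) //; congr (_ + _).
rewrite taylor_part_sum //; apply: eq_bigr => k _.
rewrite (@taylor_partM _ _ b (fun u => contracted j k u - frame_dev j k u)) //; last exact: smoothB.
by apply: eq_bigr => p _; rewrite taylor_partB // contracted_taylor.
Qed.

End StructureEquation.

End ExpCoordinates.

(** * The contact form on brackets *)

Section LieBracket.
Variables (R : realType) (N : nat) (M : topologicalType) (A : set (chart R N M)).
Hypothesis mfd : oriented_manifold A.
Variables (D : set M) (oD : open D).
Implicit Types (V : vfield R M) (p : M).

Lemma tvec_lin p v (a b : R[i]) f g : ctangent A p v -> msmooth_at A f p ->
  msmooth_at A g p -> v (fun q => a * f q + b * g q) = a * v f + b * v g.
Proof.
move=> tv sf sg; rewrite (tvecD tv) ?(tvecZ tv) //; exact: msmoothZ.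
Qed.

(** The shape a v + b w, with b = 0, is the one to which [form_lin] applies directly. *)
Lemma lie_anti V (V' : vfield R M) p : lie A V V' p = fun f => -1 * lie A V' V p f + 0 * lie A V' V p f.
Proof.
apply/funext => f; rewrite mul0r addr0 mulN1r /lie; case: asboolP => _.
  by rewrite opprB.
by rewrite oppr0.
Qed.

Lemma lie_linl (V1 V2 V' : vfield R M) (a b : R[i]) p : D p ->
  smooth_vf A D V1 -> smooth_vf A D V2 -> smooth_vf A D V' ->
  lie A (fun q f => a * V1 q f + b * V2 q f) V' p =
  fun f => a * lie A V1 V' p f + b * lie A V2 V' p f.
Proof.
move=> Dp [t1 s1] [t2 s2] [t' s']; apply/funext => f; rewrite /lie.
case: asboolP => sf; last by rewrite !mulr0 addr0.
rewrite (tvec_lin _ _ (t' p Dp)); [ring|exact: s1|exact: s2].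
Qed.

Lemma lie_linr (V1 V2 V' : vfield R M) (a b : R[i]) p : D p ->
  smooth_vf A D V1 -> smooth_vf A D V2 -> smooth_vf A D V' ->
  lie A V' (fun q f => a * V1 q f + b * V2 q f) p =
  fun f => a * lie A V' V1 p f + b * lie A V' V2 p f.
Proof.
move=> Dp s1 s2 s'; rewrite lie_anti lie_linl //; apply/funext => f.
by rewrite (lie_anti V' V1) (lie_anti V' V2); ring.
Qed.

Lemma lieJ V (V' : vfield R M) p : lie A (conjvf V) (conjvf V') p = conjv (lie A V V' p).
Proof.
apply/funext => f; rewrite /conjv /lie.
have -> : `[< msmooth_at A (fun q => (f q)^*) p >] = `[< msmooth_at A f p >].
  by apply: asbool_equiv_eq; split=> [/msmoothJE|/msmoothJ].
case: asboolP => sf; last by rewrite conjc0.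
rewrite [RHS]rmorphB /conjvf /conjv; congr (_ ^* - _ ^*).
  by congr (V p); apply/funext => q; rewrite conjcK.
by congr (V' p); apply/funext => q; rewrite conjcK.
Qed.

Section OneForm.
Variables (theta : oneform R M) (theta1 : real_oneform A theta).

Lemma ctangent0 p v : ctangent A p v -> ctangent A p (fun=> 0).
Proof.
move=> tv; have := ctangent_lin 0 0 tv tv.
by congr (ctangent A p _); apply/funext => f; rewrite !mul0r addr0.
Qed.

Lemma form_lin p v w (a b : R[i]) : ctangent A p v -> ctangent A p w ->
  theta p (fun f => a * v f + b * w f) = a * theta p v + b * theta p w.
Proof.
move=> tv tw; have t0 := ctangent0 tv.
have z : theta p (fun=> 0) = 0.
  have := form_linear theta1 1 t0 t0.
  have -> : (fun _ : M -> R[i] => 1 * 0 + 0) = (fun=> 0 : R[i]).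
    by apply/funext => f; rewrite mulr0 addr0.
  rewrite mul1r => H.
  by apply: (addrI (theta p (fun=> 0))); rewrite -H addr0.
have tbw : ctangent A p (fun f => b * w f).
  have := ctangent_lin b 0 tw t0.
  by congr (ctangent A p _); apply/funext => f; rewrite mulr0 addr0.
rewrite (form_linear theta1 a tv tbw); congr (_ + _).
have := form_linear theta1 b tw t0; rewrite z addr0 => <-.
by congr (theta p _); apply/funext => f; rewrite addr0.
Qed.

(** The vector [w] supplies the tangency of the zero functional, which is the empty sum. *)
Lemma form_sum p (I : Type) (r : seq I) (a : I -> R[i]) (v : I -> tvec R M) w :
  ctangent A p w -> (forall i, ctangent A p (v i)) ->
  ctangent A p (fun f => \sum_(i <- r) a i * v i f) /\
  theta p (fun f => \sum_(i <- r) a i * v i f) = \sum_(i <- r) a i * theta p (v i).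
Proof.
move=> tw tv; elim: r => [|i r [IHt IH]].
  under eq_fun do rewrite big_nil; split; first exact: ctangent0 tw.
  transitivity (theta p (fun f => 0 * w f + 0 * w f)); last first.
    by rewrite form_lin // big_nil !mul0r addr0.
  by congr (theta p _); apply/funext => f; rewrite !mul0r addr0.
have -> : (fun f => \sum_(j <- i :: r) a j * v j f) =
    (fun f => a i * v i f + 1 * (\sum_(j <- r) a j * v j f)).
  by apply/funext => f; rewrite big_cons mul1r.
split; first exact: ctangent_lin.
by rewrite form_lin // IH big_cons mul1r.
Qed.

End OneForm.
End LieBracket.

(** * Values of the contact form on brackets of the orthonormal frame *)

Section WebsterFrame.
Variables (R : realType) (M : topologicalType) (n : nat).
Local Notation N := (n + n).+1.
Variables (A : set (chart R N M)) (T10 : M -> set (tvec R M)) (theta : oneform R M).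
Variables (T : vfield R M) (W : set M) (Z : 'I_n -> vfield R M).
Hypothesis mfd : oriented_manifold A.
Hypothesis cr : cr_structure A n T10.
Hypothesis ct : contact_form A T10 theta.
Hypothesis reeb : reeb_field A theta T.
Hypothesis onf : orthonormal_frame A T10 theta W Z.

Let X := real_frame Z T.
Let theta1 := contact_form1 ct.

Lemma conjcM (z w : R[i]) : conjc (z * w) = conjc z * conjc w.
Proof. exact: (rmorphM conjc). Qed.

Lemma conjcD (z w : R[i]) : conjc (z + w) = conjc z + conjc w.
Proof. exact: (rmorphD conjc). Qed.

Lemma conjcN (z : R[i]) : conjc (- z) = - conjc z.
Proof. exact: (rmorphN conjc). Qed.

(** The scalars for which sqrt 2 Re Z is [re_scale] times Z + conj Z and sqrt 2 Im Z is [im_scale]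
    times Z - conj Z. *)
Definition re_scale : R[i] := (Num.sqrt 2)%:C * 2^-1.
Definition im_scale : R[i] := (Num.sqrt 2)%:C * (2 * 'i%C)^-1.

Lemma real_frame_re a : X (hor (lshift n a)) =
  fun p f => re_scale * Z a p f + re_scale * conjvf (Z a) p f.
Proof.
apply/funext => p; rewrite /X /real_frame /hor liftK.
rewrite (_ : fintype.split (lshift n a) = inl a); last exact: (unsplitK (inl a)).
by apply/funext => f; rewrite /Rev /re_scale -mulrDr mulrA.
Qed.

Lemma real_frame_im a : X (hor (rshift n a)) =
  fun p f => im_scale * Z a p f + - im_scale * conjvf (Z a) p f.
Proof.
apply/funext => p; rewrite /X /real_frame /hor liftK.
rewrite (_ : fintype.split (rshift n a) = inr a); last exact: (unsplitK (inr a)).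
by apply/funext => f; rewrite /Imv /im_scale mulNr -mulrBr mulrA.
Qed.

Lemma real_frame_vert : X vert = T.
Proof. by apply/funext => p; rewrite /X /real_frame /vert unlift_none. Qed.

Lemma frame_index_ind (P : 'I_N -> Prop) :
  (forall a, P (hor (lshift n a))) -> (forall a, P (hor (rshift n a))) -> P vert ->
  forall j, P j.
Proof.
move=> Pl Pr Pv j; have Ph (k : 'I_(n + n)) : P (hor k).
  by case: (split_ordP k) => a ->.
by case: (unliftP ord_max j) => [k ->|->] //; exact: Ph.
Qed.

Let oW : open W := frame_open onf.1.

Lemma frame_smooth a : smooth_vf A W (Z a).
Proof. by have [] := frame_section onf.1 a. Qed.

Lemma real_frame_smooth j : smooth_vf A W (X j).
Proof.
have s a := frame_smooth a; have sJ a := smooth_vfJ (frame_smooth a).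
elim/frame_index_ind: j => [a|a|].
- by rewrite real_frame_re; exact: smooth_vf_lin.
- by rewrite real_frame_im; exact: smooth_vf_lin.
- rewrite real_frame_vert; have [tT sT] := reeb_smooth reeb.
  by split=> [p _|p f _]; [exact: tT|exact: sT].
Qed.

Lemma re_scaleJ : conjc re_scale = re_scale.
Proof. by rewrite /re_scale conjcM conjc_real conjc_inv conjc_nat. Qed.

Lemma im_scaleJ : conjc im_scale = - im_scale.
Proof.
rewrite /im_scale conjcM conjc_real conjc_inv conjcM conjc_nat.
have -> : conjc ('i%C : R[i]) = - 'i%C by apply/eqP; rewrite eq_complex /= oppr0 !eqxx.
by rewrite mulrN invrN mulrN.
Qed.

Lemma real_frame_real j p : realv (X j p).
Proof.
elim/frame_index_ind: j => [a|a|].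
- rewrite /realv real_frame_re; apply/funext => f; rewrite /conjv /conjvf /conjv.
  rewrite conjcD !(conjcM re_scale) re_scaleJ conjcK addrC; congr (_ * _ + _).
  by congr (Z a p); apply/funext => q; rewrite conjcK.
- rewrite /realv real_frame_im; apply/funext => f; rewrite /conjv /conjvf /conjv.
  rewrite conjcD (conjcM im_scale) (conjcM (- im_scale)) conjcN im_scaleJ opprK conjcK addrC; congr (_ * _ + _).
  by congr (Z a p); apply/funext => q; rewrite conjcK.
- by rewrite real_frame_vert; exact: (reeb_real reeb).
Qed.

(** The contact form is known to kill real parts only, which makes theta(v) purely imaginary. The
    same for i v, which is in T10 since the fibre is a complex span, makes theta(v) real. *)
Lemma form_T10 p v : ctangent A p v -> T10 p v -> theta p v = 0.
Proof.
move=> tv Tv.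
have [D' [Z' [Op fr]]] := cr_subbundle cr p; have sp := frame_span fr Op.
have T0 : T10 p (fun=> 0).
  rewrite sp; exists (fun=> 0); apply/funext => f; rewrite /lincomb big1 // => i _.
  by rewrite mul0r.
have Re0 w : ctangent A p w -> T10 p w -> theta p w + conjc (theta p w) = 0.
  move=> tw Tw.
  have : levi_dist T10 p (Rev w).
    exists w, (fun=> 0); split=> //; congr Rev; apply/funext => f.
    by rewrite /conjv conjc0 addr0.
  move=> /(contact_annihilates ct).
  have -> : Rev w = fun f => 2^-1 * w f + 2^-1 * conjv w f.
    by apply/funext => f; rewrite /Rev mulrDr.
  rewrite (form_lin theta1) //; last exact: ctangentJ.
  rewrite (form_real theta1) // -mulrDr => /eqP.
  by rewrite mulf_eq0 invr_eq0 pnatr_eq0 => /eqP.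
pose iv : tvec R M := fun f => 'i%C * v f + 0 * v f.
have tiv : ctangent A p iv by exact: ctangent_lin.
have Tiv : T10 p iv.
  have : T10 p v := Tv; rewrite sp => -[c vE].
  exists (fun i => 'i%C * c i); apply/funext => f; rewrite /iv vE mul0r addr0 /lincomb mulr_sumr; apply: eq_bigr => i _.
  by rewrite mulrA.
have := Re0 v tv Tv; have := Re0 iv tiv Tiv.
rewrite (form_lin theta1) // mul0r addr0; case: (theta p v) => a b.
move=> /eqP; rewrite eq_complex /= => /andP[/eqP H1 _] /eqP.
rewrite eq_complex /= => /andP[/eqP H2 _].
apply/eqP; rewrite eq_complex /=; apply/andP; split; apply/eqP; lra.
Qed.

Lemma form_conj p v : ctangent A p v -> T10 p v -> theta p (conjv v) = 0.
Proof. by move=> tv Tv; rewrite (form_real theta1) // form_T10 // conjc0. Qed.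

Lemma frame_T10 a p : W p -> T10 p (Z a p).
Proof. by have [_] := frame_section onf.1 a; apply. Qed.

Lemma form_frame a p : W p -> theta p (Z a p) = 0 /\ theta p (conjvf (Z a) p) = 0.
Proof.
move=> Wp; have [tZ _] := frame_smooth a.
by rewrite form_T10 ?form_conj //; [exact: tZ|exact: frame_T10|exact: tZ|exact: frame_T10].
Qed.

Lemma form_real_frame j p : W p -> theta p (X j p) = (j == vert)%:R.
Proof.
move=> Wp; elim/frame_index_ind: j => [a|a|].
- have [z1 z2] := form_frame a Wp; have [tZ _] := frame_smooth a.
  rewrite real_frame_re (form_lin theta1) ?z1 ?z2 ?mulr0 ?addr0; last 2 first.
    exact: tZ. exact/ctangentJ/tZ.
  by rewrite /hor /vert eq_sym (negbTE (neq_lift _ _)).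
- have [z1 z2] := form_frame a Wp; have [tZ _] := frame_smooth a.
  rewrite real_frame_im (form_lin theta1) ?z1 ?z2 ?mulr0 ?addr0; last 2 first.
    exact: tZ. exact/ctangentJ/tZ.
  by rewrite /hor /vert eq_sym (negbTE (neq_lift _ _)).
- by rewrite real_frame_vert eqxx; exact: (reeb_contact reeb).
Qed.

Lemma form_lie_T10 a b p : W p -> theta p (lie A (Z a) (Z b) p) = 0.
Proof.
move=> Wp; apply: form_T10.
  exact: (lie_tangent mfd oW Wp (frame_smooth a) (frame_smooth b)).
by apply: (cr_integrable cr oW) => //; exact: (frame_section onf.1).
Qed.

Lemma form_lie_conj a b p : W p ->
  theta p (lie A (conjvf (Z a)) (conjvf (Z b)) p) = 0.
Proof.
move=> Wp; rewrite lieJ (form_real theta1) ?form_lie_T10 ?conjc0 //.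
exact: (lie_tangent mfd oW Wp (frame_smooth a) (frame_smooth b)).
Qed.

(** As theta vanishes on the frame and its conjugate throughout [W], only the bracket survives in d
    theta. Orthonormality then says that i/2 times theta [Z_a, conj Z_b] is the Kronecker delta. *)
Lemma form_lie_mixed a b p : W p ->
  theta p (lie A (Z a) (conjvf (Z b)) p) = - (2 * 'i%C) * (a == b)%:R.
Proof.
move=> Wp; have [_ /(_ p a b Wp)] := onf; rewrite /levi /dform.
have [tZ _] := frame_smooth a; have [tZ' _] := smooth_vfJ (frame_smooth b).
have nW : \forall q \near p, W q by exact: open_nbhs_nbhs.
have -> : Z a p (fun q => theta q (conjvf (Z b) q)) = 0.
  rewrite -(tvec0 (tZ p Wp)); apply: (tvec_near mfd (tZ p Wp)).
  by apply: filterS nW => q /(form_frame b)[].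
have -> : conjvf (Z b) p (fun q => theta q (Z a q)) = 0.
  rewrite -(tvec0 (tZ' p Wp)); apply: (tvec_near mfd (tZ' p Wp)).
  by apply: filterS nW => q /(form_frame a)[].
rewrite subrr sub0r => <-.
move: (theta p _) => t.
have i2 : ('i%C * 'i%C : R[i]) = -1 by rewrite -expr2 sqr_i.
have -> : - (2 * 'i%C) * (- 'i%C * (2^-1 * - t)) = - ('i%C * 'i%C) * (2 * 2^-1) * t by ring.
by rewrite i2 opprK mulfV ?pnatr_eq0 // !mul1r.
Qed.

(** Expand bilinearly: integrability removes [Z_a, Z_b] and its conjugate, and the two mixed
    brackets enter with opposite signs. *)
Lemma form_lie_frame a b (c1 c2 e1 e2 : R[i]) p : W p ->
  theta p (lie A (fun p f => c1 * Z a p f + c2 * conjvf (Z a) p f)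
    (fun p f => e1 * Z b p f + e2 * conjvf (Z b) p f) p) =
  2 * 'i%C * (c2 * e1 - c1 * e2) * (a == b)%:R.
Proof.
move=> Wp; have sa := frame_smooth a; have sb := frame_smooth b.
have sa' := smooth_vfJ sa; have sb' := smooth_vfJ sb.
have t V V' : smooth_vf A W V -> smooth_vf A W V' -> ctangent A p (lie A V V' p).
  exact: lie_tangent.
rewrite (lie_linl _ _ Wp) //; last exact: smooth_vf_lin.
rewrite !(lie_linr _ _ Wp) //.
rewrite !(form_lin theta1); try by [exact: t | apply: ctangent_lin; exact: t].
rewrite form_lie_T10 // form_lie_conj // form_lie_mixed //.
rewrite lie_anti (form_lin theta1); try exact: t.
by rewrite form_lie_mixed // [b == a]eq_sym; ring.
Qed.

Lemma scale_mul : 2 * 'i%C * (re_scale * im_scale + re_scale * im_scale) = 2.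
Proof.
rewrite /re_scale /im_scale.
have s2 : (Num.sqrt 2)%:C * (Num.sqrt 2)%:C = 2 :> R[i].
  by rewrite -real_complexM -expr2 sqr_sqrtr // (rmorph_nat (real_complex R)).
have -> : 2 * 'i%C * ((Num.sqrt 2)%:C / 2 * ((Num.sqrt 2)%:C / (2 * 'i%C)) +
   (Num.sqrt 2)%:C / 2 * ((Num.sqrt 2)%:C / (2 * 'i%C))) =
   ((Num.sqrt 2)%:C * (Num.sqrt 2)%:C) * ((2 * 'i%C) / (2 * 'i%C)) * (2 * 2^-1) :> R[i] by ring.
rewrite s2 !divff ?mulr1 ?pnatr_eq0 //.
by rewrite mulf_neq0 ?pnatr_eq0 // eq_complex /= oner_eq0 andbF.
Qed.

End WebsterFrame.

(** * Weighted remainders *)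

Section WeightedRemainder.
Variables (R : realType) (n : nat).
Local Notation N := (n + n).+1.
Implicit Types (u : 'rV[R]_N) (J : seq 'I_N) (c : seq 'I_N -> R).

Lemma hor_neq_vert (k : 'I_(n + n)) : (hor k == vert) = false.
Proof. by rewrite /hor /vert eq_sym (negbTE (neq_lift _ _)). Qed.

Lemma hor_inj : injective (@hor n).
Proof. exact: lift_inj. Qed.

Lemma sum_hor_vert (V : nmodType) (f : 'I_N -> V) :
  \sum_i f i = \sum_(k < n + n) f (hor k) + f vert.
Proof. by rewrite (bigD1_ord ord_max) //= addrC. Qed.

Lemma hnorm_ge0 u : 0 <= hnorm u.
Proof. by rewrite addr_ge0 ?sqrtr_ge0 // sumr_ge0. Qed.

Lemma coord_hnorm u k : `|u 0 k| <= hnorm u ^+ (1 + (k == vert)).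
Proof.
case: (unliftP ord_max k) => [i ->|->].
  rewrite -/(hor i) hor_neq_vert addn0 expr1 /hnorm (bigD1 i) //= -addrA lerDl.
  by rewrite addr_ge0 ?sqrtr_ge0 // sumr_ge0.
rewrite -[ord_max]/(@vert n) eqxx -[leLHS]sqr_sqrtr // lerXn2r ?nnegrE ?sqrtr_ge0 ?hnorm_ge0 //.
by rewrite /hnorm lerDr sumr_ge0.
Qed.

Lemma upow_hnorm u J : `|upow u J| <= hnorm u ^+ wnorm J.
Proof.
elim: J => [|k J IH]; first by rewrite /upow big_nil normr1 expr0.
rewrite upow_cons normrM.
have -> : wnorm (k :: J) = (1 + (k == vert) + wnorm J)%N by rewrite /wnorm /=; lia.
by rewrite exprD ler_pM // coord_hnorm.
Qed.

Lemma near_small (e : R) : 0 < e -> \forall u \near (0 : 'rV[R]_N), `|u| <= e.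
Proof.
by move=> e0; apply/nbhs_normP; exists e => // u; rewrite /ball_ /= sub0r normrN => /ltW.
Qed.

Lemma hnorm_le1 : \forall u \near (0 : 'rV[R]_N), hnorm u <= 1.
Proof.
(* Chosen so that the horizontal sum is at most 1/4 and the square root at most 1/2. *)
pose e : R := (4 * N%:R)^-1.
have e0 : 0 < e by rewrite invr_gt0 mulr_gt0 ?ltr0n.
apply: filterS (near_small e0) => u ue.
have Ne : N%:R * e = 4^-1 by rewrite /e invfM mulrCA divff ?mulr1 // pnatr_eq0.
have ule4 : e <= 4^-1 by rewrite -Ne -[leLHS]mul1r (ler_wpM2r (ltW e0)) // ler1n.
have S1 : \sum_(k < n + n) `|u 0 (hor k)| <= 4^-1.
  apply: (@le_trans _ _ (\sum_(k < n + n) e)).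
    by apply: ler_sum => k _; rewrite (le_trans (norm_coord_le _ _)).
  rewrite sumr_const card_ord -[leLHS]mulr_natl -Ne (ler_wpM2r (ltW e0)) // ler_nat.
  exact: leqnSn.
have S2 : Num.sqrt `|u 0 vert| <= 2^-1.
  have -> : 2^-1 = Num.sqrt (2^-1 ^+ 2) :> R by rewrite sqrtr_sqr ger0_norm // invr_ge0.
  rewrite ler_wsqrtr // (le_trans (norm_coord_le _ _)) // (le_trans ue) //.
  by rewrite (le_trans ule4) // expr2 -invfM -natrM.
by rewrite /hnorm; lra.
Qed.

(** The vertical coordinate is bounded by the square of [hnorm], which is at most [hnorm] itself
    when the latter is at most 1. *)
Lemma norm_hnorm u : hnorm u <= 1 -> `|u| <= hnorm u.
Proof.
move=> u1; rewrite [leLHS]/Num.Def.normr /= mx_normrE.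
apply: bigmax_le; first exact: hnorm_ge0.
move=> [i k] _ /=; rewrite (ord1 i) (le_trans (coord_hnorm u k)) //.
by rewrite exprD expr1 ler_piMr ?hnorm_ge0 // exprn_ile1 ?hnorm_ge0.
Qed.

Lemma weighted_O_le a (r : 'rV[R]_N -> R) (K : R) :
  (\forall u \near (0 : 'rV[R]_N), `|r u| <= K * hnorm u ^+ a) -> weighted_O a r.
Proof.
move=> H; apply/eqO_exP; exists (`|K| + 1); first by rewrite ltr_wpDl.
apply: filterS H => u Hu; apply: le_trans Hu _.
rewrite [X in _ <= _ * X]ger0_norm ?exprn_ge0 ?hnorm_ge0 // ler_wpM2r ?exprn_ge0 ?hnorm_ge0 //.
by rewrite (le_trans (ler_norm K)) // lerDl.
Qed.

(** Words of length at most [a] are sorted by weight: below [lo], from [lo] to [a], above [a]. The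
    last group and the ordinary remainder are both of weighted order a + 1; [lo <= a.+1] keeps the
    outer groups disjoint. *)
Lemma wpoly_remainder (f : 'rV[R]_N -> R) c (lo a : nat) (K : R) : (lo <= a.+1)%N ->
  (\forall u \near (0 : 'rV[R]_N),
    `|f u - \sum_(b < a.+1) word_part u b c| <= K * `|u| ^+ a.+1) ->
  weighted_O a.+1 (fun u => f u -
    \sum_(b < a.+1) \sum_(J : b.-tuple 'I_N | (wnorm J < lo)%N) c J * upow u J -
    wpoly lo a c u).
Proof.
move=> loa H.
apply: (@weighted_O_le _ _ (`|K| + \sum_(b < a.+1) \sum_(J : b.-tuple 'I_N) `|c J|)).
apply: filterS2 H hnorm_le1 => u Hu u1.
pose hi := \sum_(b < a.+1) \sum_(J : b.-tuple 'I_N | (a < wnorm J)%N) c J * upow u J.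
have -> : f u - \sum_(b < a.+1) \sum_(J : b.-tuple 'I_N | (wnorm J < lo)%N) c J * upow u J -
    wpoly lo a c u = (f u - \sum_(b < a.+1) word_part u b c) + hi.
  have E : \sum_(b < a.+1) word_part u b c =
      \sum_(b < a.+1) \sum_(J : b.-tuple 'I_N | (wnorm J < lo)%N) c J * upow u J +
      wpoly lo a c u + hi.
    rewrite /wpoly /hi -!big_split; apply: eq_bigr => b _ /=.
    rewrite /word_part (bigID (fun J : b.-tuple 'I_N => (wnorm J < lo)%N)) /= -addrA; congr (_ + _).
    rewrite (bigID (fun J : b.-tuple 'I_N => (wnorm J <= a)%N)) /=; congr (_ + _).
      by apply: eq_bigl => J; rewrite -leqNgt.
    by apply: eq_bigl => J; rewrite -leqNgt -ltnNge; lia.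
  by rewrite E; ring.
rewrite (le_trans (ler_normD _ _)) // mulrDl lerD //.
  apply: le_trans Hu _; apply: (@le_trans _ _ (`|K| * `|u| ^+ a.+1)).
    by rewrite ler_wpM2r ?exprn_ge0 // ler_norm.
  by rewrite ler_wpM2l // lerXn2r ?nnegrE ?hnorm_ge0 // norm_hnorm.
rewrite (le_trans (ler_norm_sum _ _ _)) // mulr_suml; apply: ler_sum => b _.
rewrite (le_trans (ler_norm_sum _ _ _)) // mulr_suml.
rewrite [leRHS](bigID (fun J : b.-tuple 'I_N => (a < wnorm J)%N)) /= -[leLHS]addr0.
rewrite lerD //; last by apply: sumr_ge0 => J _; rewrite mulr_ge0 ?exprn_ge0 ?hnorm_ge0.
apply: ler_sum => J aJ; rewrite normrM ler_wpM2l //.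
apply: le_trans (upow_hnorm u J) _.
by rewrite ler_wiXn2l ?hnorm_ge0.
Qed.

Lemma low_words1 c (a : nat) u : c [::] = 0 ->
  \sum_(b < a.+1) \sum_(J : b.-tuple 'I_N | (wnorm J < 1)%N) c J * upow u J = 0.
Proof.
move=> c0; rewrite big1 // => b _; rewrite big1 // => J; rewrite /wnorm ltnS leqn0 addn_eq0.
by move=> /andP[/nilP -> _]; rewrite c0 mul0r.
Qed.

(** Below weight 2 there are only the empty word and the single horizontal letters: [vert] alone
    already has weight 2. *)
Lemma low_words2 c (a : nat) u : (1 <= a)%N -> c [::] = 0 ->
  \sum_(b < a.+1) \sum_(J : b.-tuple 'I_N | (wnorm J < 2)%N) c J * upow u J =
  \sum_(k < n + n) c [:: hor k] * u 0 (hor k).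
Proof.
case: a => // a _ c0.
have mk b : \sum_(J : b.-tuple 'I_N | (wnorm J < 2)%N) c J * upow u J =
    \sum_(J : b.-tuple 'I_N) (if (wnorm J < 2)%N then c J * upow u J else 0).
  by rewrite big_mkcond.
rewrite big_ord_recl big_ord_recl [X in _ + (_ + X)]big1 => [|b _]; last first.
  rewrite big1 // => J; rewrite /wnorm size_tuple /= /bump /=; lia.
rewrite addr0 !mk /=.
rewrite (sum_tuple0 (fun J => if (wnorm J < 2)%N then c J * upow u J else 0)).
have w0 : (wnorm ([::] : seq 'I_N) < 2)%N by [].
rewrite w0 c0 mul0r.
rewrite add0r.
rewrite (sum_tupleS 0 (fun J => if (wnorm J < 2)%N then c J * upow u J else 0)).
rewrite sum_hor_vert -[RHS]addr0; congr (_ + _).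
  apply: eq_bigr => k _.
  rewrite (sum_tuple0 (fun J => if (wnorm (hor k :: J) < 2)%N then c (hor k :: J) * upow u (hor k :: J) else 0)).
  by rewrite /wnorm /= hor_neq_vert /upow big_seq1.
rewrite (sum_tuple0 (fun J => if (wnorm (vert :: J) < 2)%N then c (vert :: J) * upow u (vert :: J) else 0)).
by rewrite /wnorm /= eqxx.
Qed.

End WeightedRemainder.

(** * The weighted expansion of the horizontal fields *)

Section Expansion.
Variables (R : realType) (n : nat) (M : topologicalType).
Local Notation N := (n + n).+1.
Variables (A : set (chart R N M)) (T10 : M -> set (tvec R M)) (theta : oneform R M).
Variables (T : vfield R M) (x : M) (W : set M) (Z : 'I_n -> vfield R M).
Variables (U : set 'rV[R]_N) (V : set M) (E : 'rV[R]_N -> M) (F : M -> 'rV[R]_N).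
Variable C : 'I_N -> 'I_N -> 'I_N -> 'rV[R]_N -> R.
Let X := real_frame Z T.
Hypothesis mfd : oriented_manifold A.
Hypothesis cr : cr_structure A n T10.
Hypothesis ct : contact_form A T10 theta.
Hypothesis reeb : reeb_field A theta T.
Hypothesis onf : orthonormal_frame A T10 theta W Z.
Hypothesis expE : exp_coordinates A W X x U V E F.
Hypothesis HC : structure_functions A X U E C.
Implicit Types (u : 'rV[R]_N) (j k : 'I_(n + n)).

Let sX := real_frame_smooth reeb onf.
Let rX (j : 'I_N) (p : M) (_ : W p) : realv (X j p) := real_frame_real Z reeb j p.
Let W0 : W (E 0) := exp_in_W expE (exp_dom0 expE).

(** Theta takes the value 1 on T and 0 on the other frame fields, so it extracts the vertical
    coefficient. *)
Lemma vert_bracket (j k : 'I_N) :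
  (C vert j k 0)%:C = theta (E 0) (lie A (X j) (X k) (E 0)).
Proof.
rewrite (HC j k (exp_dom0 expE)) /lincomb.
have tX i : ctangent A (E 0) (X i (E 0)) by have [tX _] := sX i; exact: tX.
have [_ ->] := form_sum (contact_form1 ct) (index_enum 'I_N)
  (fun i => (C i j k 0)%:C) (tX vert) tX.
rewrite (bigD1 vert) //= (form_real_frame cr ct reeb onf _ W0) eqxx mulr1.
rewrite big1 ?addr0 // => i /negPf iv.
by rewrite (form_real_frame cr ct reeb onf _ W0) iv mulr0.
Qed.

Lemma vert_bracket_re_re a b : C vert (hor (lshift n a)) (hor (lshift n b)) 0 = 0.
Proof.
apply: complexI; rewrite [LHS]vert_bracket /X !real_frame_re (form_lie_frame mfd cr ct onf) //.
by rewrite subrr mulr0 mul0r.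
Qed.

Lemma vert_bracket_im_im a b : C vert (hor (rshift n a)) (hor (rshift n b)) 0 = 0.
Proof.
apply: complexI; rewrite [LHS]vert_bracket /X !real_frame_im (form_lie_frame mfd cr ct onf) //.
by rewrite mulNr mulrN subrr mulr0 mul0r.
Qed.

Lemma vert_bracket_re_im a b :
  C vert (hor (lshift n a)) (hor (rshift n b)) 0 = 2 * (a == b)%:R.
Proof.
apply: complexI; rewrite [LHS]vert_bracket /X real_frame_re real_frame_im.
rewrite (form_lie_frame mfd cr ct onf) // mulrN opprK scale_mul.
by case: (a == b); rewrite ?mulr1 ?mulr0 ?(rmorph_nat (real_complex R)).
Qed.

Lemma vert_bracket_im_re a b :
  C vert (hor (rshift n a)) (hor (lshift n b)) 0 = - (2 * (a == b)%:R).
Proof.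
apply: complexI; rewrite [LHS]vert_bracket /X real_frame_re real_frame_im.
rewrite (form_lie_frame mfd cr ct onf) //.
have -> : - im_scale R * re_scale R - im_scale R * re_scale R =
  - (re_scale R * im_scale R + re_scale R * im_scale R) by ring.
rewrite mulrN scale_mul.
by case: (a == b); rewrite ?mulr1 ?mulr0 ?oppr0 // (rmorphN (real_complex R)) (rmorph_nat (real_complex R)).
Qed.

Definition expansion_coef j (i : 'I_N) (J : seq 'I_N) : R :=
  coef_eval (frame_poly R j i J) (structure_coef C).

Lemma expansion_coef_nil j i : expansion_coef j i [::] = 0.
Proof. by rewrite /expansion_coef frame_poly_eval. Qed.

(** A one-letter word has no proper cut, so only the term K remains, with the factor 1/(1 + 1). *)
Lemma expansion_coef_hor j k :
  expansion_coef j vert [:: hor k] = 2^-1 * C vert (hor k) (hor j) 0.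
Proof.
rewrite /expansion_coef frame_poly_eval /= big1 => [|p]; last first.
  by case: p => [[|p] pb] //.
rewrite addr0; congr (_ * _).
(* In degree 0 the averaging identity identifies the coefficient of the empty monomial with the
   value at 0. *)
have := mon_sum_average (fun J => iter_partial J (C vert (hor k) (hor j)) 0) 0 (0 : 'rV[R]_N).
rewrite (sum_tuple0 (fun J => iter_partial J (C vert (hor k) (hor j)) 0 * upow 0 J)).
rewrite (sum_tuple0 (fun J => (mon_words J)%:R^-1 *
  structure_coef C vert (hor k) (hor j) (word_mon J) * upow 0 J)).
by rewrite /upow big_nil !mulr1 fact0 invr1 mul1r.
Qed.

(** Among horizontal fields only X_(n+alpha) has a vertical bracket with X_alpha at the base point;
    half of its coefficient -2 gives -1. *)
Lemma linear_part_re a u :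
  \sum_(k < n + n) expansion_coef (lshift n a) vert [:: hor k] * u 0 (hor k) =
  - u 0 (hor (rshift n a)).
Proof.
rewrite big_split_ord /= big1 ?add0r => [|b _]; last first.
  by rewrite expansion_coef_hor vert_bracket_re_re mulr0 mul0r.
rewrite (bigD1 a) //= big1 ?addr0 => [|b /negPf ba]; last first.
  by rewrite expansion_coef_hor vert_bracket_im_re ba mulr0 oppr0 mulr0 mul0r.
by rewrite expansion_coef_hor vert_bracket_im_re eqxx mulr1 mulrN mulVf ?mulN1r // pnatr_eq0.
Qed.

Lemma linear_part_im a u :
  \sum_(k < n + n) expansion_coef (rshift n a) vert [:: hor k] * u 0 (hor k) =
  u 0 (hor (lshift n a)).
Proof.
rewrite big_split_ord /= [X in _ + X]big1 ?addr0 => [|b _]; last first.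
  by rewrite expansion_coef_hor vert_bracket_im_im mulr0 mul0r.
rewrite (bigD1 a) //= big1 ?addr0 => [|b /negPf ba]; last first.
  by rewrite expansion_coef_hor vert_bracket_re_im ba !mulr0 mul0r.
by rewrite expansion_coef_hor vert_bracket_re_im eqxx mulr1 mulVf ?mul1r // pnatr_eq0.
Qed.

(** [lin] abstracts the linear vertical term, so that one argument serves both families of
    fields. *)
Lemma frame_expansion (a : nat) j (lin : 'rV[R]_N -> R) : (1 <= a)%N ->
  (forall u, \sum_(k < n + n) expansion_coef j vert [:: hor k] * u 0 (hor k) = lin u) ->
  exists2 r : 'I_N -> 'rV[R]_N -> R, forall i, weighted_O a.+1 (r i) &
  forall u, U u -> X (hor j) (E u) = fun f =>
    coord_vec A E (hor j) u f + (lin u)%:C * coord_vec A E vert u f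
    + \sum_(i < n + n) (wpoly 1 a (expansion_coef j (hor i)) u + r (hor i) u)%:C *
        coord_vec A E (hor i) u f
    + (wpoly 2 a (expansion_coef j vert) u + r vert u)%:C * coord_vec A E vert u f.
Proof.
move=> a1 linE; pose D i := frame_dev X E F (hor j) i.
have bnd i : exists K : R, \forall u \near (0 : 'rV[R]_N),
    `|D i u - \sum_(b < a.+1) word_part u b (expansion_coef j i)| <= K * `|u| ^+ a.+1.
  have [K HK] := taylor_bound a.+1 (frame_dev_smooth sX expE (hor j) i).
  exists K; apply: filterS HK => u; congr (`|_ - _| <= _).
  apply: eq_bigr => b _; rewrite -(frame_dev_taylor mfd sX rX expE HC _ _ _ (leqnn b)).
  apply: eq_bigr => J _; rewrite /expansion_coef frame_poly_eval size_tuple.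
  by [].
(* Defined as whatever is left over, so the expansion is exact on all of [U]; only the order of [r]
   is a statement about u near 0. *)
pose r i u := D i u - (if i == vert then lin u else 0) -
  wpoly (if i == vert then 2 else 1)%N a (expansion_coef j i) u.
exists r => [i|u Uu].
  have [K HK] := bnd i; rewrite /r.
  case: eqVneq => [iv|iv].
    have := wpoly_remainder (lo := 2) _ HK; rewrite ltnS => /(_ a1).
    congr weighted_O; apply/funext => u.
    by rewrite low_words2 ?expansion_coef_nil // iv linE.
  have := wpoly_remainder (lo := 1) _ HK => /(_ isT).
  congr weighted_O; apply/funext => u.
  by rewrite low_words1 ?expansion_coef_nil.
rewrite [LHS](frame_coord_vec mfd sX rX expE (hor j) Uu); apply/funext => f.
rewrite sum_hor_vert.
have cE i : frame_coef X E F (hor j) i u = (hor j == i)%:R + D i u.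
  by rewrite /D /frame_dev addrC subrK.
have -> : frame_coef X E F (hor j) vert u =
    lin u + (wpoly 2 a (expansion_coef j vert) u + r vert u).
  rewrite cE /r eqxx hor_neq_vert add0r.
  by rewrite [X in _ + X]addrC subrK addrC subrK.
have -> : \sum_(i < n + n) (frame_coef X E F (hor j) (hor i) u)%:C * coord_vec A E (hor i) u f =
    coord_vec A E (hor j) u f +
    \sum_(i < n + n) (wpoly 1 a (expansion_coef j (hor i)) u + r (hor i) u)%:C *
        coord_vec A E (hor i) u f.
  rewrite [X in _ = X + _](_ : _ = \sum_(i < n + n) (hor j == hor i)%:R * coord_vec A E (hor i) u f).
    rewrite -big_split; apply: eq_bigr => i _ /=; rewrite -mulrDl; congr (_ * _).
    rewrite cE /r hor_neq_vert subr0 [wpoly _ _ _ _ + _]addrC subrK.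
    by rewrite real_complexD; case: (_ == _).
  rewrite (bigD1 j) //= eqxx mul1r big1 ?addr0 // => i ij.
  by rewrite (inj_eq (@hor_inj n)) eq_sym (negbTE ij) mul0r.
by rewrite real_complexD mulrDl addrA; congr (_ + _); rewrite addrAC.
Qed.

End Expansion.

(** The order of quantifiers carries the uniformity: the polynomials precede the manifold, and the
    constants [c] precede the order [a]. *)
Theorem theorem2p2 (R : realType) (n : nat) (n_gt0 : (0 < n)%N) :
  exists2 P : forall (j : 'I_(n + n)) (i : 'I_(n + n).+1) (J : seq 'I_(n + n).+1),
      structure_poly R n (wnorm J),
    forall j i J, degree_le (wnorm J) (P j i J) &
  forall (M : topologicalType) (A : set (chart R (n + n).+1 M))
    (T10 : M -> set (tvec R M)) (theta : oneform R M) (T : vfield R M)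
    (x : M) (W : set M) (Z : 'I_n -> vfield R M)
    (U : set 'rV[R]_(n + n).+1) (V : set M)
    (E : 'rV[R]_(n + n).+1 -> M) (F : M -> 'rV[R]_(n + n).+1)
    (C : 'I_(n + n).+1 -> 'I_(n + n).+1 -> 'I_(n + n).+1 -> 'rV[R]_(n + n).+1 -> R),
  let X := real_frame Z T in
  oriented_manifold A ->
  cr_structure A n T10 ->
  contact_form A T10 theta ->
  reeb_field A theta T ->
  W x ->
  orthonormal_frame A T10 theta W Z ->
  exp_coordinates A W X x U V E F ->
  structure_functions A X U E C ->
  exists c : 'I_(n + n) -> 'I_(n + n).+1 -> seq 'I_(n + n).+1 -> R,
    (forall (a : nat) (alpha : 'I_n), (1 <= a)%N ->
      (exists2 r : 'I_(n + n).+1 -> 'rV[R]_(n + n).+1 -> R,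
        forall i, weighted_O a.+1 (r i) &
        forall u, U u ->
          let j := lshift n alpha in
          let d i := coord_vec A E i u in
          X (hor j) (E u) = fun f =>
            d (hor j) f - (u 0 (hor (rshift n alpha)))%:C * d vert f
            + \sum_(i < n + n) (wpoly 1 a (c j (hor i)) u + r (hor i) u)%:C * d (hor i) f
            + (wpoly 2 a (c j vert) u + r vert u)%:C * d vert f) /\
      (exists2 r : 'I_(n + n).+1 -> 'rV[R]_(n + n).+1 -> R,
        forall i, weighted_O a.+1 (r i) &
        forall u, U u ->
          let j := rshift n alpha in
          let d i := coord_vec A E i u in
          X (hor j) (E u) = fun f =>
            d (hor j) f + (u 0 (hor (lshift n alpha)))%:C * d vert f
            + \sum_(i < n + n) (wpoly 1 a (c j (hor i)) u + r (hor i) u)%:C * d (hor i) f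
            + (wpoly 2 a (c j vert) u + r vert u)%:C * d vert f)) /\
    (exists2 q : 'I_(n + n).+1 -> 'I_(n + n).+1 -> 'I_(n + n).+1 ->
        multinom (n + n).+1 -> R,
      radial_coefs C q &
      forall j i J, c j i J = coef_eval (P j i J) q).
Proof.
exists (frame_poly R (n:=n)); first exact: frame_poly_degree.
move=> M A T10 theta T x W Z U V E F C X mfd cr ct reeb Wx onf expE HC.
exists (expansion_coef C); split=> [a alpha a1|].
  split.
    have [r rO rE] := frame_expansion mfd reeb onf expE HC a1
      (linear_part_re mfd cr ct reeb onf expE HC alpha).
    exists r => // u Uu /=; rewrite [LHS](rE u Uu); apply/funext => f.
    by rewrite (rmorphN (real_complex R)) mulNr.
  have [r rO rE] := frame_expansion mfd reeb onf expE HC a1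
    (linear_part_im mfd cr ct reeb onf expE HC alpha).
  by exists r => // u Uu /=; rewrite [LHS](rE u Uu).
exists (structure_coef C) => //; apply: radial_coefs_taylor => i j k.
exact: (structure_smooth mfd (real_frame_smooth reeb onf)
  (fun j p _ => real_frame_real Z reeb j p) expE HC).
Qed.
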